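(* Let $K$ be a compact subset of $\mathbb{V}=S^n\setminus\overline{S}^{n-1}_+$, let $c\in(0,\frac13]$ be a constant with $v\ge 3c$ on $K$, and let $$U:=\{x=(x_1,\dots,x_{n+1})\in\mathbb{V}:\ v(x)=\sqrt{x_1^2+x_2^2}>2c\},$$ so that $K\subset U$. For any compact subset $\Phi$ of $(0,2\pi)$ there exists a smooth family of nonnegative smooth functions $F(\cdot,\varphi_0)$ ($\varphi_0\in\Phi$) on $U$ such that: (i) $F(\cdot,\varphi_0)$ is strictly convex on $K$; (ii) $F(x,\varphi_0)=0$ if and only if $x=x_{\varphi_0}:=(\sin\varphi_0,\cos\varphi_0,0,\dots,0)$; (iii) $F(x,\varphi_0)\le 1$ (respectively $F(x,\varphi_0)<1$) if and only if $(x,x_{\varphi_0})\ge\frac32 c$ (respectively $(x,x_{\varphi_0})>\frac32c$) and $|\varphi(x)-\varphi_0|\le\pi$.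
   Context: $S^n\subset\mathbb{R}^{n+1}$ ($n\ge2$) is the unit sphere with its canonical metric, $(\cdot,\cdot)$ is the Euclidean inner product, and $\overline{S}^{n-1}_+=\{x\in S^n: x_1=0,\ x_2\ge0\}$. For $x\in\mathbb{V}$ there are a unique $v=v(x)\in(0,1]$ and a unique $\varphi=\varphi(x)\in(0,2\pi)$ with $(x_1,x_2)=(v\sin\varphi,v\cos\varphi)$; $v$ and $\varphi$ are smooth functions on $\mathbb{V}$. ''Strictly convex on $K$'' means that the Riemannian Hessian is positive definite at every point of $K$. ''Smooth family'' means smooth dependence on $(x,\varphi_0)$. *)

(* Defs.v *)
From mathcomp Require Import all_boot all_order all_algebra.
From mathcomp Require Import all_classical all_reals all_analysis.
From mathcomp Require Import ring lra.
Set Implicit Arguments.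
Unset Strict Implicit.
Unset Printing Implicit Defensive.
Import Order.TTheory GRing.Theory Num.Theory.
Import numFieldNormedType.Exports.
Local Open Scope classical_set_scope.
Local Open Scope ring_scope.

Section Smoothness.
Variables (R : realType) (V : normedModType R).

(* C^infinity on [W], for [W] open and [V] finite-dimensional: every iterated
   directional derivative is Frechet differentiable on [W]. *)
Definition smooth_open (W : set V) (g : V -> R) : Prop :=
  forall (s : seq V) (p : V), W p ->
    differentiable (foldr (fun u h => 'D_u h) g s : V -> R) p.

(* Smoothness on an arbitrary subset: local extendability to a smooth function
   on an open set of the ambient space.  On a relatively open subset of the
   sphere this is smoothness for the submanifold structure. *)
Definition smooth_on (A : set V) (f : V -> R) : Prop :=
  forall p, A p -> exists (W : set V) (g : V -> R),
    [/\ open W, W p, smooth_open W g & forall q, A q -> W q -> f q = g q].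

End Smoothness.

Section Sphere.
Variables (R : realType) (n : nat).
Local Notation E := 'rV[R]_n.+1.
Implicit Types (x p u w : E) (f : E -> R) (K : set E).

(* The library norm on ['rV[R]_n.+1] is the sup norm, hence this separate
   Euclidean structure. *)
Definition dotp u w : R := \sum_i u 0 i * w 0 i.
Definition enorm u : R := Num.sqrt (dotp u u).

Definition sphere : set E := [set x | enorm x = 1].

Definition tangent p : set E := [set w | dotp w p = 0].
Definition tproj p w : E := w - dotp w p *: p.

(* Derivative at [p] in the sphere, along the tangent vector [w], of a map
   [X] on the sphere.  [X] is only meaningful on the sphere, so it is first
   precomposed with the radial retraction [y |-> y / |y|], whose differential
   at [p] is the identity on the tangent space. *)
Definition sderive (W : normedModType R) (X : E -> W) p w : W :=
  'D_w (fun y => X ((enorm y)^-1 *: y)) p.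

(* The tangent vector with [dotp (sgrad f p) w = sderive f p w] for every
   tangent [w]; its [i]-th coordinate is the derivative of [f] along the
   tangential part of the [i]-th basis vector. *)
Definition sgrad f p : E := \row_i sderive f p (tproj p (delta_mx 0 i)).

(* Levi-Civita connection of the round metric: tangential part of the
   Euclidean derivative. *)
Definition nabla (X : E -> E) p w : E := tproj p (sderive X p w).

Definition Hess f p u w : R := dotp (nabla (sgrad f) p u) w.

Definition strictly_convex_on K f : Prop :=
  forall p, K p -> forall w, tangent p w -> w != 0 -> 0 < Hess f p w w.

End Sphere.

Section Domain.
Variables (R : realType) (n : nat).
Local Notation E := 'rV[R]_n.+1.
Implicit Types (x : E) (c t : R).

(* The coordinates written x_1 and x_2 in 1-based numbering; [inord 1] is the
   index 1 as soon as [0 < n]. *)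
Definition crd1 x : R := x 0 ord0.
Definition crd2 x : R := x 0 (inord 1).

Definition half_sphere : set E :=
  [set x | [/\ sphere x, crd1 x = 0 & 0 <= crd2 x]].

Definition VV : set E := @sphere R n `\` half_sphere.

Definition vfun x : R := Num.sqrt (crd1 x ^+ 2 + crd2 x ^+ 2).

Definition is_angle x t : Prop :=
  [/\ 0 < t, t < 2 * pi, crd1 x = vfun x * sin t & crd2 x = vfun x * cos t].

Definition angle x : R := xget 0 [set t | is_angle x t].

Definition UU c : set E := [set x | VV x /\ 2 * c < vfun x].

Definition xpt t : E :=
  \row_i (if i == ord0 then sin t else if i == inord 1 then cos t else 0).

Lemma vfun_gt0 x : VV x -> 0 < vfun x.
Proof.
move=> [Sx Hx]; rewrite /vfun sqrtr_gt0 lt0r addr_ge0 ?sqr_ge0 // andbT.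
rewrite paddr_eq0 ?sqr_ge0 // !sqrf_eq0; apply/negP => /andP[/eqP x1 /eqP x2].
by apply: Hx; split; rewrite // x2.
Qed.

Lemma is_angle_inj x s t : VV x -> is_angle x s -> is_angle x t -> s = t.
Proof.
move=> /vfun_gt0 v0.
wlog lst : s t / s < t.
  move=> H; case: (ltgtP s t) => // st hs ht; first exact: H.
  by apply/esym; apply: H.
move=> [s0 _ s1 s2] [_ t2 t1 t3]; exfalso.
have vn0 : vfun x != 0 by rewrite gt_eqF.
have es : sin s = sin t by apply: (mulfI vn0); rewrite -s1 -t1.
have ec : cos s = cos t by apply: (mulfI vn0); rewrite -s2 -t3.
have c1 : cos (t - s) = 1 by rewrite cosB es ec -!expr2 cos2Dsin2.
set d := (t - s) / 2.
have dE : t - s = d *+ 2 by rewrite /d -mulr_natr divfK // pnatr_eq0.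
have d0 : 0 < sin d.
  apply: sin_gt0_pi; rewrite /d; apply/andP; split.
    by rewrite divr_gt0 // subr_gt0.
  by rewrite ltr_pdivrMr // [_ * 2]mulrC (lt_trans _ t2) // ltrBlDr ltrDl.
have := exprn_gt0 2 d0; move: c1; rewrite dE cos_mulr2n cos2sin2.
by move=> h1 h2; lra.
Qed.

Lemma angleP x : VV x -> is_angle x (angle x).
Proof.
move=> Vx; have v0 := vfun_gt0 Vx; have vn0 : vfun x != 0 by rewrite gt_eqF.
apply: (@xgetPex _ 0 [set t | is_angle x t]).
pose a := crd1 x / vfun x; pose b := crd2 x / vfun x.
have ea : crd1 x = vfun x * a by rewrite /a mulrC divfK.
have eb : crd2 x = vfun x * b by rewrite /b mulrC divfK.
have ab : a ^+ 2 + b ^+ 2 = 1.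
  apply: (mulfI (expf_neq0 2 vn0)).
  rewrite mulrDr -!exprMn -ea -eb mulr1 sqr_sqrtr //.
  by rewrite addr_ge0 ?sqr_ge0.
have b1 : b <> 1.
  move=> b1; case: Vx => Sx; apply; split => //; last first.
    by rewrite eb b1 mulr1 ltW.
  have /eqP : a ^+ 2 = 0 by move: ab; rewrite b1 expr1n => h; lra.
  rewrite sqrf_eq0 => /eqP a0.
  by rewrite ea a0 mulr0.
have bN1 : `|b| <= 1.
  by rewrite -(@expr_le1 _ 2) // real_normK ?num_real // -ab lerDr sqr_ge0.
move: (bN1); rewrite ler_norml => bb.
have acos0 : 0 < acos b.
  rewrite lt0r acos_ge0 // andbT; apply/eqP => h; apply: b1.
  by rewrite -(acosK bb) h cos0.
have sE : sin (acos b) = `|a|.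
  by rewrite sin_acos // -ab addrK sqrtr_sqr.
have pp : acos b < 2 * pi.
  by rewrite (le_lt_trans (acos_lepi bb)) // mulr_natl mulr2n ltrDl pi_gt0.
case: (leP 0 a) => a0.
  exists (acos b); split => //; first by rewrite sE ger0_norm.
  by rewrite acosK.
exists (2 * pi - acos b); split.
- by rewrite subr_gt0.
- by rewrite ltrBlDr ltrDl.
- rewrite addrC mulr_natl sinD2pi sinN sE ltr0_norm // opprK //.
- by rewrite addrC mulr_natl cosD2pi cosN acosK.
Qed.

End Domain.

(* Main.v *)
From HB Require Import structures.
Require Import Defs.
From mathcomp Require Import all_boot all_order all_algebra.
From mathcomp Require Import all_classical all_reals all_analysis.
From mathcomp Require Import ring lra.
Set Implicit Arguments.
Unset Strict Implicit.
Unset Printing Implicit Defensive.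
Import Order.TTheory GRing.Theory Num.Theory.
Import numFieldNormedType.Exports.
Local Open Scope classical_set_scope.
Local Open Scope ring_scope.

(** Put k = 3c/2, A(v) = arccos (k/v) and, for a large constant l,

      z(x,t) = cosh (l (phi(x) - t)) / cosh (l A(v(x))),
      F(x,t) = (z(x,t) - m) / (1 - m),   m = 1 / cosh (l A(1)).

    Since (x, x_t) = v cos (phi - t), the inequality F <= 1 says z <= 1, that
    is |phi - t| <= A(v), and this means that |phi - t| <= pi and
    (x, x_t) >= k: a single formula in (v, phi) selects the right sheet of the
    cap ([cap_family_le1P], [cap_family_lt1P]).  Since cosh >= 1 and A is
    increasing, z >= m, with equality only for phi = t and v = 1, that is at
    x_t ([cap_family_eq0P], [xpt_eq]).

    Strict convexity where v >= 3c = 2k.  For large l the function log z is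
    close to l (|phi - t| - A(v)).  The level sets of |phi - t| - A(v) are
    rotations, about the axis x_1 = x_2 = 0, of pieces of the small sphere
    (x, x_t) = k; they bound strictly convex regions, and the exponential of a
    large multiple of a function with such level sets is strictly convex.
    The hyperbolic cosine rounds off the corner of |phi - t| at phi = t and
    puts the minimum at x_t.  All bounds depend on c alone, so that
    l = 1 + 2/c^3 can be chosen uniformly in x and t.

    To carry this out, the Hessian is expressed as an ordinary second
    derivative: Hess f p w w is the second derivative at s = 0 of
    s |-> f ((p + s w) / |p + s w|)  ([Hess_jet2]).  It follows from Euler's
    identity for the radial extension y |-> f (y / |y|), which is homogeneous
    of degree 0.  Along this curve the quotient z''/z is an explicit quadratic
    form in v'/v, phi' and |w| ([jet2_wave]); [tangent_split] bounds v'/v by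
    the part of |w|^2 that does not come from phi', and [wave_form_gt0] is the
    resulting estimate.

    Smoothness follows from the closed formula
    phi = pi - 2 arctan (x_1 / (v - x_2)), valid off the half plane
    x_1 = 0, x_2 >= 0, and from closure properties of the functions that are
    differentiable arbitrarily often. *)

(** * Functions that are differentiable several times *)

(** Differentiability is a property of germs; it lets the derivatives computed
    on an open set [W] be replaced by their formulas. *)
Lemma near_eq_differentiable (R : realType) (V : normedModType R)
    (f g : V -> R) (p : V) :
  (\forall q \near p, f q = g q) -> differentiable f p -> differentiable g p.
Proof.
move=> fg df; have fgp : f p = g p by exact: nbhs_singleton fg.
have fg0 : \forall h \near (0 : V), f (h + p) = g (h + p).
  by move: fg; rewrite (near_shift 0); apply: filterS => h /=; rewrite subr0.
have gE : g \o shift p = cst (g p) + 'd f p +o_ (0 : V) id.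
  apply/eqaddoP => e e0; have /eqaddoP/(_ e e0) := diff_locally df.
  apply: filterS2 fg0 => h /= hE.
  by rewrite /= fgp !fctE /= hE.
have dE := diff_unique (diff_continuous df) gE.
by apply/diff_locallyP; rewrite dE; split => //; exact: diff_continuous.
Qed.

Section ContinuousDifferentiability.
Variables (R : realType) (V : normedModType R) (W : set V).
Hypothesis openW : open W.
Implicit Types (f g : V -> R) (k j : nat) (p u : V).

(** Regularity of order [k.+1] by directional derivatives, with the order as a
    parameter: closure properties are then proved by induction on [k], through
    the formula for the first derivative. *)
Fixpoint ndiff k f : Prop :=
  (forall p, W p -> differentiable f p) /\
  (if k is j.+1 then forall u, ndiff j ('D_u f) else True).

Lemma ndiff_differentiable k f p : ndiff k f -> W p -> differentiable f p.
Proof. by case: k => [|k] [df _]; exact: df. Qed.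

Lemma ndiffW k j f : (j <= k)%N -> ndiff k f -> ndiff j f.
Proof.
elim: k j f => [|k IH] [|j] f //= jk; first by case.
by case=> df Df; split=> // u; apply: IH.
Qed.

Lemma ndiff_derive k f u : ndiff k.+1 f -> ndiff k ('D_u f).
Proof. by move=> [_ Df]; exact: Df. Qed.

Lemma near_open (P : V -> Prop) p :
  W p -> (forall q, W q -> P q) -> \forall q \near p, P q.
Proof. by move=> Wp WP; apply: filterS WP _; exact: open_nbhs_nbhs. Qed.

Lemma ndiff_eq k f g : (forall p, W p -> f p = g p) -> ndiff k f -> ndiff k g.
Proof.
elim: k f g => [|k IH] f g fg /= [df Df].
all: have dg p (Wp : W p) : differentiable g p
  by apply: near_eq_differentiable (df _ Wp); exact: near_open Wp fg.
- by [].
- split=> // u; apply: IH (Df u) => p Wp.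
  by apply: near_eq_derive; exact: near_open Wp fg.
Qed.

Lemma ndiff_cst k (x : R) : ndiff k (cst x).
Proof.
elim: k x => [|k IH] x; split=> // u.
by apply: ndiff_eq (IH 0) => p _; rewrite derive_cst.
Qed.

Lemma ndiff_linear k f : linear f -> continuous f -> ndiff k f.
Proof.
move=> lf cf.
pose fM := GRing.isLinear.Build _ _ _ _ _ lf.
pose fL : {linear V -> R} := HB.pack f fM.
have df p : differentiable f p by exact: (@linear_differentiable _ _ _ fL).
case: k => [|k]; split=> // u.
apply: ndiff_eq (ndiff_cst _ (f u)) => p Wp.
by rewrite deriveE // (@diff_lin _ _ _ fL).
Qed.

Lemma ndiffD k f g : ndiff k f -> ndiff k g -> ndiff k (fun p => f p + g p).
Proof.
elim: k f g => [|k IH] f g [df Df] [dg Dg].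
all: have dfg p (Wp : W p) : differentiable (f + g) p
  by apply: differentiableD; [exact: df|exact: dg].
- by [].
- split=> // u; apply: ndiff_eq (IH _ _ (Df u) (Dg u)) => p Wp.
  by rewrite -[RHS]/('D_u (f + g) p) deriveD //;
    apply: diff_derivable; [exact: df|exact: dg].
Qed.

Lemma ndiffM k f g : ndiff k f -> ndiff k g -> ndiff k (fun p => f p * g p).
Proof.
elim: k f g => [|k IH] f g hf hg; have [df Df] := hf; have [dg Dg] := hg.
all: have dfg p (Wp : W p) : differentiable (f * g) p
  by apply: differentiableM; [exact: df|exact: dg].
- by [].
- split=> // u; have hfg := ndiffD (IH _ _ (ndiffW (leqnSn k) hf) (Dg u))
                                  (IH _ _ (ndiffW (leqnSn k) hg) (Df u)).
  apply: ndiff_eq hfg => p Wp.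
  by rewrite -[RHS]/('D_u (f * g) p) deriveM //;
    apply: diff_derivable; [exact: df|exact: dg].
Qed.

Lemma derive_comp1 f (h : R -> R) (h' : R) p u :
  differentiable f p -> is_derive (f p) 1 h h' ->
  differentiable (h \o f) p /\ 'D_u (h \o f) p = h' * 'D_u f p.
Proof.
move=> df [/derivable1_diffP dh hh].
have dhf : differentiable (h \o f) p by exact: differentiable_comp.
split=> //; rewrite !deriveE // diff_comp //= diff1E //= derive1E hh.
by rewrite mulrC.
Qed.

(** Bootstrapping.  The derivative of [h \o f] is a factor [e] times that of
    [f], and [e] is usually an expression in [h \o f] itself; so regularity of
    [h \o f] at one order yields it at the next. *)
Lemma ndiff_comp k f (h : R -> R) (e : V -> R) :
  ndiff k f -> (forall p, W p -> is_derive (f p) 1 h (e p)) ->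
  (forall j, (j < k)%N -> ndiff j (h \o f) -> ndiff j e) ->
  ndiff k (h \o f).
Proof.
move=> hf dh he.
suff H j : (j <= k)%N -> ndiff j (h \o f) by exact: H.
have d p (Wp : W p) u := derive_comp1 u (ndiff_differentiable hf Wp) (dh p Wp).
elim: j => [|j IH] jk; split=> //; first by move=> p Wp; have [] := d p Wp 0.
  by move=> p Wp; have [] := d p Wp 0.
move=> u; have [_ Df] := ndiffW jk hf.
apply: ndiff_eq (ndiffM (he j jk (IH (ltnW jk))) (Df u)) => p Wp.
by have [_ ->] := d p Wp u.
Qed.

Lemma ndiffN k f : ndiff k f -> ndiff k (fun p => - f p).
Proof.
move=> hf; apply: ndiff_eq (ndiffM (ndiff_cst k (-1)) hf) => p _.
by rewrite /= mulN1r.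
Qed.

Lemma ndiffB k f g : ndiff k f -> ndiff k g -> ndiff k (fun p => f p - g p).
Proof. by move=> hf hg; exact: ndiffD hf (ndiffN hg). Qed.

Lemma ndiffX k f m : ndiff k f -> ndiff k (fun p => f p ^+ m).
Proof.
move=> hf; elim: m => [|m IH]; first exact: ndiff_cst.
by apply: ndiff_eq (ndiffM hf IH) => p _; rewrite exprS.
Qed.

Lemma is_derive_inv (x : R) : x != 0 -> is_derive x 1 GRing.inv (- x ^- 2).
Proof.
move=> x0; split; first by apply/derivable1_diffP; exact: differentiable_Rinv.
by rewrite deriveE ?diff_Rinv //=; [exact: mulr1|exact: differentiable_Rinv].
Qed.

Lemma ndiffV k f : (forall p, W p -> f p != 0) ->
  ndiff k f -> ndiff k (fun p => (f p)^-1).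
Proof.
move=> f0 hf; apply: (ndiff_comp (e := fun p => - (f p)^-1 ^+ 2) hf) => [p|j _].
  by move=> /f0 fp0; rewrite exprVn; exact: is_derive_inv.
by move=> h; apply: ndiffN; exact: ndiffX.
Qed.

Lemma ndiff_expR k f : ndiff k f -> ndiff k (fun p => expR (f p)).
Proof.
move=> hf; apply: (ndiff_comp (e := fun p => expR (f p)) hf) => //.
Qed.

Lemma ndiff_sqrt k f : (forall p, W p -> 0 < f p) ->
  ndiff k f -> ndiff k (fun p => Num.sqrt (f p)).
Proof.
move=> f0 hf.
apply: (ndiff_comp (e := fun p => (2 * Num.sqrt (f p))^-1) hf) => [p Wp|j _ h].
  by apply: is_derive1_sqrt; exact: f0.
apply: ndiffV => [p Wp|]; last exact: ndiffM (ndiff_cst _ 2) h.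
by rewrite mulf_neq0 // gt_eqF // sqrtr_gt0; exact: f0.
Qed.

Lemma ndiff_atan k f : ndiff k f -> ndiff k (fun p => atan (f p)).
Proof.
move=> hf.
apply: (@ndiff_comp k f atan (fun p => (1 + f p ^+ 2)^-1)) => // j jk _.
apply: ndiffV => [p _|]; first by rewrite gt_eqF // ltr_wpDr // sqr_ge0.
exact: ndiffD (ndiff_cst _ 1) (ndiffX _ (ndiffW (ltnW jk) hf)).
Qed.

Lemma ndiff_acos k f : (forall p, W p -> -1 < f p < 1) ->
  ndiff k f -> ndiff k (fun p => acos (f p)).
Proof.
move=> f1 hf.
have sf p : W p -> 0 < 1 - f p ^+ 2.
  by move=> /f1 /andP[fl fr]; nra.
apply: (ndiff_comp (e := fun p => - (Num.sqrt (1 - f p ^+ 2))^-1) hf) => [p Wp|j jk _].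
  by apply: is_derive1_acos; exact: f1.
apply/ndiffN/ndiffV => [p Wp|]; first by rewrite gt_eqF // sqrtr_gt0; exact: sf.
apply: ndiff_sqrt => //.
exact: ndiffB (ndiff_cst _ 1) (ndiffX _ (ndiffW (ltnW jk) hf)).
Qed.

Lemma smooth_open_ndiff f : (forall k, ndiff k f) -> smooth_open W f.
Proof.
move=> hf s; elim/last_ind: s f hf => [|s u IH] f hf p Wp /=.
  exact: ndiff_differentiable (hf 0%N) Wp.
rewrite foldr_rcons; apply: IH => // k.
exact: ndiff_derive.
Qed.

End ContinuousDifferentiability.

(** * Hyperbolic functions and second-order jets *)

Section RealDerivatives.
Variable R : realType.
Implicit Types (f g h : R -> R) (b c d l s x y : R).

Lemma is_derive1D f g s df dg : is_derive s 1 f df -> is_derive s 1 g dg ->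
  is_derive s 1 (fun x => f x + g x) (df + dg).
Proof. by move=> hf hg; exact: is_deriveD. Qed.

Lemma is_derive1B f g s df dg : is_derive s 1 f df -> is_derive s 1 g dg ->
  is_derive s 1 (fun x => f x - g x) (df - dg).
Proof. by move=> hf hg; exact: is_deriveB. Qed.

Lemma is_derive1M f g s df dg : is_derive s 1 f df -> is_derive s 1 g dg ->
  is_derive s 1 (fun x => f x * g x) (df * g s + f s * dg).
Proof.
move=> hf hg; apply: (is_derive_eq (is_deriveM hf hg)).
by rewrite addrC /GRing.scale /= [g s * _]mulrC.
Qed.

Lemma is_derive1V g s dg : g s != 0 -> is_derive s 1 g dg ->
  is_derive s 1 (fun x => (g x)^-1) (- dg / g s ^+ 2).
Proof.
move=> g0 hg; apply: (is_derive_eq (is_derive1_comp (is_derive_inv g0) hg)).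
by rewrite mulrC mulrN -mulNr.
Qed.

Lemma is_derive1_div f g s df dg : g s != 0 ->
  is_derive s 1 f df -> is_derive s 1 g dg ->
  is_derive s 1 (fun x => f x / g x) ((df * g s - f s * dg) / g s ^+ 2).
Proof.
move=> g0 hf hg; apply: (is_derive_eq (is_derive1M hf (is_derive1V g0 hg))).
by field.
Qed.

Definition cosh x := (expR x + expR (- x)) / 2.
Definition sinh x := (expR x - expR (- x)) / 2.

Lemma is_derive_cosh x : is_derive x 1 cosh (sinh x).
Proof.
have e := is_derive_expR x.
have n := is_derive1_comp (is_derive_expR (- x)) (is_deriveNid x 1).
apply: (is_derive_eq (is_derive1M (is_derive1D e n) (is_derive_cst (2^-1 : R) x 1))).
by rewrite /sinh /cst; ring.
Qed.

Lemma is_derive_sinh x : is_derive x 1 sinh (cosh x).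
Proof.
have e := is_derive_expR x.
have n := is_derive1_comp (is_derive_expR (- x)) (is_deriveNid x 1).
apply: (is_derive_eq (is_derive1M (is_derive1B e n) (is_derive_cst (2^-1 : R) x 1))).
by rewrite /cosh /cst; ring.
Qed.

Lemma cosh2Bsinh2 x : cosh x ^+ 2 - sinh x ^+ 2 = 1.
Proof.
rewrite /cosh /sinh -[RHS](expR0 R) -(subrr x) expRD.
by set a := expR x; set b := expR _; field.
Qed.

Lemma cosh_gt0 x : 0 < cosh x.
Proof. by rewrite divr_gt0 // addr_gt0 // expR_gt0. Qed.

Lemma sinh_gt0 x : 0 < x -> 0 < sinh x.
Proof. by move=> x0; rewrite divr_gt0 // subr_gt0 ltr_expR gtrN. Qed.

Lemma coshN x : cosh (- x) = cosh x.
Proof. by rewrite /cosh opprK addrC. Qed.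

Lemma cosh_norm x : cosh `|x| = cosh x.
Proof.
by case: (leP 0 x) => h; [rewrite ger0_norm|rewrite ltr0_norm // coshN].
Qed.

Lemma cosh0 : cosh 0 = 1.
Proof. by rewrite /cosh oppr0 expR0 -mulr2n -mulr_natr mul1r divff. Qed.

Lemma ltr_cosh x y : 0 <= x -> x < y -> cosh x < cosh y.
Proof.
move=> x0 xy.
have [a0 b0] := (expR_gt0 x, expR_gt0 y).
have ab : expR x < expR y by rewrite ltr_expR.
have a1 : 1 <= expR x by rewrite -expR0 ler_expR.
rewrite /cosh !expRN ltr_pM2r ?invr_gt0 // -subr_gt0.
set a := expR x in a0 a1 ab *; set b := expR y in b0 ab *.
have -> : b + b^-1 - (a + a^-1) = (b - a) * (a * b - 1) / (a * b).
  by field; rewrite !gt_eqF.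
by rewrite divr_gt0 ?mulr_gt0 ?subr_gt0 //; nra.
Qed.

Lemma ltr_cosh_norm x y : (cosh x < cosh y) = (`|x| < `|y|).
Proof.
rewrite -(cosh_norm x) -(cosh_norm y).
case: (ltgtP `|x| `|y|) => [h|h|->]; last by rewrite ltxx.
  by apply: ltr_cosh.
by apply/negbTE; rewrite -leNgt ltW // ltr_cosh.
Qed.

Lemma ler_cosh_norm x y : (cosh x <= cosh y) = (`|x| <= `|y|).
Proof. by rewrite !leNgt ltr_cosh_norm. Qed.

Lemma cosh_ge1 x : 1 <= cosh x.
Proof. by rewrite -cosh0 ler_cosh_norm normr0. Qed.

Lemma cosh_eq1 x : cosh x = 1 -> x = 0.
Proof.
move=> h; apply/eqP; rewrite -normr_le0 -[leRHS](normr0 R) -ler_cosh_norm.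
by rewrite h cosh0.
Qed.

Lemma cosh_ge_half x : x / 2 <= cosh x.
Proof.
rewrite /cosh ler_pM2r ?invr_gt0 //.
have := expR_ge1Dx x; have := expR_gt0 (- x); lra.
Qed.

(** Rules of calculus for the pair [b = f'(0)], [c = f''(0)] give the second
    derivative of a long composite without its first derivative ever being
    written down away from 0. *)
Definition jet2 f b c := exists f' : R -> R,
  [/\ \forall s \near (0 : R), is_derive (s : R) 1 f (f' s), f' 0 = b & is_derive (0 : R) 1 f' c].

Lemma jet2_derive f b c : jet2 f b c -> is_derive (0 : R) 1 f b.
Proof. by case=> f' [/nbhs_singleton + <-]. Qed.

Lemma is_derive1_continuous f s df : is_derive s 1 f df -> {for s, continuous f}.
Proof.
by move=> [/derivable1_diffP d _]; exact: differentiable_continuous.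
Qed.

Lemma jet2_continuous f b c : jet2 f b c -> {for 0, continuous f}.
Proof. by move/jet2_derive; exact: is_derive1_continuous. Qed.

Lemma jet2_eq f b c b' c' : jet2 f b c -> b = b' -> c = c' -> jet2 f b' c'.
Proof. by move=> ? <- <-. Qed.

Lemma jet2_unique f b c b' c' : jet2 f b c -> jet2 f b' c' -> c = c'.
Proof.
move=> [f1 [d1 _ [_ <-]]] [f2 [d2 _ [_ <-]]]; apply: near_eq_derive.
by apply: filterS2 d1 d2 => s [_ <-] [_ <-].
Qed.

Lemma jet2_affine x y : jet2 (fun s => x + s * y) y 0.
Proof.
exists (cst y); split => //.
  near=> s; apply: (is_derive_eq (is_derive1D (is_derive_cst x s 1)
    (is_derive1M (is_derive_id s 1) (is_derive_cst y s 1)))).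
  by rewrite /cst /=; ring.
exact: is_derive_cst.
Unshelve. all: end_near. Qed.

Lemma jet2D f b c g b' c' : jet2 f b c -> jet2 g b' c' ->
  jet2 (fun s => f s + g s) (b + b') (c + c').
Proof.
move=> [f' [df <- df']] [g' [dg <- dg']]; exists (fun s => f' s + g' s); split=> //.
  by apply: filterS2 df dg => s; exact: is_derive1D.
exact: is_derive1D.
Qed.

Lemma jet2M f b c g b' c' : jet2 f b c -> jet2 g b' c' ->
  jet2 (fun s => f s * g s) (b * g 0 + f 0 * b') (c * g 0 + 2 * b * b' + f 0 * c').
Proof.
move=> jf jg; have [df0 dg0] := (jet2_derive jf, jet2_derive jg).
move: jf jg => [f' [df f0 df']] [g' [dg g0 dg']].
exists (fun s => f' s * g s + f s * g' s); split; last 1 first.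
- apply: (is_derive_eq (is_derive1D (is_derive1M df' dg0) (is_derive1M df0 dg'))).
  by rewrite f0 g0; ring.
- by apply: filterS2 df dg => s; exact: is_derive1M.
- by rewrite f0 g0.
Qed.

Lemma jet2_comp f b c h h' d2 : jet2 f b c ->
  (\forall x \near f 0, is_derive (x : R) 1 h (h' x)) -> is_derive (f 0) 1 h' d2 ->
  jet2 (fun s => h (f s)) (h' (f 0) * b) (d2 * b ^+ 2 + h' (f 0) * c).
Proof.
move=> jf dh dh'; have cf := jet2_continuous jf; have df0 := jet2_derive jf.
move: jf => [f' [df f0 df']].
exists (fun s => h' (f s) * f' s); split; last 1 first.
- apply: (is_derive_eq (is_derive1M (is_derive1_comp dh' df0) df')).
  by rewrite f0 /=; ring.
- apply: filterS2 df (cf _ dh) => s dfs dhs.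
  exact: is_derive1_comp.
- by rewrite f0.
Qed.

Lemma jet2_cosh f b c l : jet2 f b c ->
  jet2 (fun s => cosh (l * f s)) (l * sinh (l * f 0) * b)
    (l ^+ 2 * cosh (l * f 0) * b ^+ 2 + l * sinh (l * f 0) * c).
Proof.
move=> jf.
have dl x : is_derive x 1 (fun y => l * y) l.
  apply: (is_derive_eq (is_derive1M (is_derive_cst l x 1) (is_derive_id x 1))).
  by rewrite /cst; ring.
apply: (jet2_eq (jet2_comp jf (h := fun x => cosh (l * x))
  (h' := fun x => l * sinh (l * x)) (d2 := l ^+ 2 * cosh (l * f 0)) _ _)) => //.
- near=> x; apply: (is_derive_eq (is_derive1_comp (is_derive_cosh _) (dl x))).
  by rewrite mulrC.
- have d := is_derive1_comp (is_derive_sinh (l * f 0)) (dl (f 0)).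
  apply: (is_derive_eq (is_derive1M (is_derive_cst l (f 0) 1) d)).
  by rewrite /cst; ring.
Unshelve. all: end_near. Qed.

Lemma jet2V f b c : f 0 != 0 -> jet2 f b c ->
  jet2 (fun s => (f s)^-1) (- b / f 0 ^+ 2) (2 * b ^+ 2 / f 0 ^+ 3 - c / f 0 ^+ 2).
Proof.
move=> f0 jf.
apply: (jet2_eq (jet2_comp jf (h := GRing.inv) (h' := fun x => - (x ^- 2))
  (d2 := 2 / f 0 ^+ 3) _ _)).
- have : nbhs (f 0) [set x | x != 0] by apply: open_nbhs_nbhs; split=> //; exact: open_neq.
  by apply: filterS => x; exact: is_derive_inv.
- rewrite (_ : (fun x => _) = (fun x => - (x^-1 * x^-1))); last first.
    by apply/funext => x; rewrite -exprVn expr2.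
  have d := is_derive_inv f0.
  apply: (is_derive_eq (is_deriveN (is_derive1M d d))).
  by field.
- by rewrite mulrC mulrN mulNr.
- by rewrite mulrAC mulNr [_^-1 * _]mulrC.
Qed.

Lemma jet2_sqrt f b c : 0 < f 0 -> jet2 f b c ->
  jet2 (fun s => Num.sqrt (f s)) (b / (2 * Num.sqrt (f 0)))
    (c / (2 * Num.sqrt (f 0)) - b ^+ 2 / (4 * Num.sqrt (f 0) ^+ 3)).
Proof.
move=> f0 jf; have sf0 : Num.sqrt (f 0) != 0 by rewrite gt_eqF ?sqrtr_gt0.
have s20 : 2 * Num.sqrt (f 0) != 0 by rewrite mulf_neq0.
apply: (jet2_eq (jet2_comp jf (h := Num.sqrt) (h' := fun x => (2 * Num.sqrt x)^-1)
  (d2 := - (4 * Num.sqrt (f 0) ^+ 3)^-1) _ _)).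
- have : nbhs (f 0) [set x | 0 < x] by apply: open_nbhs_nbhs; split=> //; exact: open_gt.
  by apply: filterS => x; exact: is_derive1_sqrt.
- have d := is_derive1M (is_derive_cst (2 : R) (f 0) 1) (is_derive1_sqrt f0).
  apply: (is_derive_eq (is_derive1V (g := fun x => 2 * Num.sqrt x) s20 d)).
  by rewrite /cst; field.
- by rewrite mulrC.
- by rewrite addrC mulNr; congr (_ - _); rewrite mulrC.
Qed.

End RealDerivatives.

(** * The polar angle off a half line *)

Section PolarAngle.
Variable R : realType.
Implicit Types (a b : R).

(** The half-angle formula: for [(a, b) = v (sin phi, cos phi)], the quotient
    [a / (v - b)] is the cotangent of [phi / 2]; the arctangent then has no jump
    for [phi] between [0] and [2 pi]. *)
Definition polar_angle a b : R :=
  pi - 2 * atan (a / (Num.sqrt (a ^+ 2 + b ^+ 2) - b)).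

Lemma polar_radius_gt0 a b : b < Num.sqrt (a ^+ 2 + b ^+ 2) -> 0 < a ^+ 2 + b ^+ 2.
Proof.
move=> bv; rewrite lt0r addr_ge0 ?sqr_ge0 // andbT; apply: contraTneq bv => y0.
move/eqP: (y0); rewrite paddr_eq0 ?sqr_ge0 // => /andP[_ /eqP b0].
by move/eqP: b0; rewrite y0 sqrf_eq0 sqrtr0 => /eqP ->; rewrite ltxx.
Qed.

(** With [a / (v - b) = cot (phi / 2)], both sides are [1 / sin^2 (phi / 2)]. *)
Lemma half_angle_identity (a b v : R) : v ^+ 2 = a ^+ 2 + b ^+ 2 -> v - b != 0 ->
  1 + (a / (v - b)) ^+ 2 = 2 * v / (v - b).
Proof.
move=> v2 vb0; rewrite expr_div_n (_ : a ^+ 2 = v ^+ 2 - b ^+ 2); last by rewrite v2 addrK.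
by field.
Qed.

Lemma polar_angleP a b (v := Num.sqrt (a ^+ 2 + b ^+ 2)) : b < v ->
  [/\ 0 < polar_angle a b, polar_angle a b < 2 * pi,
      a = v * sin (polar_angle a b) & b = v * cos (polar_angle a b)].
Proof.
move=> bv; have v0 : 0 < v by rewrite sqrtr_gt0; exact: polar_radius_gt0.
have v2 : v ^+ 2 = a ^+ 2 + b ^+ 2.
  by rewrite sqr_sqrtr // addr_ge0 ?sqr_ge0.
rewrite /polar_angle -/v; set u := a / (v - b); set th := atan u.
have [th1 th2] := (atan_gtNpi2 u, atan_ltpi2 u); rewrite -/th in th1 th2.
have c0 : cos th != 0 by rewrite gt_eqF // cos_gt0_pihalf // th1 th2.
have sE : sin th = u * cos th by rewrite -[u in RHS]atanK -/th /tan divfK.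
have vb0 : v - b != 0 by rewrite subr_eq0 gt_eqF.
have c2 : cos th ^+ 2 = (v - b) / (2 * v).
  have u2 : 1 + u ^+ 2 = 2 * v / (v - b) by exact: half_angle_identity.
  have := cos2Dsin2 th; rewrite sE exprMn -[X in X + _]mul1r -mulrDl u2 => h.
  by rewrite -[LHS](mulKf (_ : 2 * v / (v - b) != 0)) ?h ?mulr1 ?invf_div //
    mulf_neq0 ?invr_neq0 // mulf_neq0 // gt_eqF.
have pE : pi - 2 * th = pi - (th + th) by rewrite mulr_natl mulr2n.
split.
- lra.
- lra.
- rewrite pE [sin _]sinB sinpi cospi mul0r sub0r mulN1r opprK sinD sE.
  rewrite (_ : _ + _ = 2 * u * cos th ^+ 2); last by ring.
  by rewrite c2 /u; field; rewrite vb0 gt_eqF.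
- rewrite pE [cos _]cosB sinpi cospi mul0r addr0 mulN1r cosD sE.
  rewrite (_ : _ - _ = 2 * cos th ^+ 2 - (1 + u ^+ 2) * cos th ^+ 2); last by ring.
  have := cos2Dsin2 th; rewrite sE exprMn -[X in X + _]mul1r -mulrDl => ->.
  by rewrite c2 mulrA; field; rewrite gt_eqF.
Qed.

Lemma is_derive_polar_angle (a b : R -> R) (a' b' s : R) :
  b s < Num.sqrt (a s ^+ 2 + b s ^+ 2) ->
  is_derive s 1 a a' -> is_derive s 1 b b' ->
  is_derive s 1 (fun x => polar_angle (a x) (b x))
    ((a' * b s - a s * b') / (a s ^+ 2 + b s ^+ 2)).
Proof.
move=> bv da db; have y0 := polar_radius_gt0 bv.
have dy := is_derive1D (is_derive1M da da) (is_derive1M db db).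
have y0' : 0 < a s * a s + b s * b s by rewrite -!expr2.
have dv := is_derive1_comp (g := fun x => a x * a x + b x * b x)
  (is_derive1_sqrt y0') dy.
have v0 : Num.sqrt (a s ^+ 2 + b s ^+ 2) - b s != 0 by rewrite subr_eq0 gt_eqF.
have v0' : Num.sqrt (a s * a s + b s * b s) - b s != 0 by rewrite -!expr2.
have du := is_derive1_div (g := fun x => Num.sqrt (a x * a x + b x * b x) - b x)
  v0' da (is_derive1B dv db).
have dt := is_derive1B (is_derive_cst (pi : R) s 1)
  (is_derive1M (is_derive_cst (2 : R) s 1) (is_derive1_comp (is_derive1_atan _) du)).
rewrite (_ : (fun x => _) = (fun x => cst (pi : R) x - cst (2 : R) x *
   (atan \o (fun x => a x / (Num.sqrt (a x * a x + b x * b x) - b x))) x)); last first.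
  by apply/funext => x; rewrite /polar_angle !expr2.
apply: (is_derive_eq dt); rewrite /cst /= -!expr2.
set v := Num.sqrt _ in bv v0 *.
have w0 : v != 0 by rewrite gt_eqF // sqrtr_gt0.
have v2 : v ^+ 2 = a s ^+ 2 + b s ^+ 2 by rewrite sqr_sqrtr // ltW.
rewrite (half_angle_identity v2 v0) -v2; move: (a s) (b s) v0 v2 => x y v0 v2.
have x2 : x ^+ 2 = v ^+ 2 - y ^+ 2 by rewrite v2 addrK.
field: x2.
by rewrite v0 w0.
Qed.
End PolarAngle.

(** * The quotient of hyperbolic cosines and its jets *)

Section Wave.
Variable R : realType.
Implicit Types (a b k l t v : R).

Definition polar_radius a b : R := Num.sqrt (a ^+ 2 + b ^+ 2).

Definition wave l k a b t : R :=
  cosh (l * (polar_angle a b - t)) / cosh (l * acos (k / polar_radius a b)).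

Lemma ndiff_cosh (V : normedModType R) (W : set V) (openW : open W) j (f : V -> R) :
  ndiff W j f -> ndiff W j (fun p => cosh (f p)).
Proof.
move=> hf; apply: ndiffM => //; last exact: ndiff_cst.
by apply: ndiffD => //; apply: ndiff_expR => //; exact: ndiffN.
Qed.

Lemma ndiff_wave (V : normedModType R) (W : set V) (openW : open W) j l k
    (a b t : V -> R) : 0 < k ->
  (forall p, W p -> b p < polar_radius (a p) (b p) /\ k < polar_radius (a p) (b p)) ->
  ndiff W j a -> ndiff W j b -> ndiff W j t ->
  ndiff W j (fun p => wave l k (a p) (b p) (t p)).
Proof.
move=> k0 Wab ha hb ht.
have hv : ndiff W j (fun p => polar_radius (a p) (b p)).
  apply: ndiff_sqrt => // [p /Wab [bv _]|]; first exact: polar_radius_gt0.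
  by apply: ndiffD => //; exact: ndiffX.
have hl : ndiff W j (cst l) by exact: ndiff_cst.
apply: ndiffM => //.
  apply: ndiff_cosh => //; apply: ndiffM => //; apply: ndiffB => //.
  apply: ndiffB => //; first exact: ndiff_cst.
  apply: ndiffM => //; first exact: ndiff_cst.
  apply: ndiff_atan => //; apply: ndiffM => //; apply: ndiffV => //; last exact: ndiffB.
  by move=> p /Wab [bv _]; rewrite subr_eq0 gt_eqF.
apply: ndiffV => // [p _|]; first by rewrite gt_eqF // cosh_gt0.
apply: ndiff_cosh => //; apply: ndiffM => //; apply: ndiff_acos => // [p /Wab [_ kv]|].
  have v0 := lt_trans k0 kv.
  by rewrite (@lt_trans _ _ 0) ?divr_gt0 //= ltr_pdivrMr // mul1r.
apply: ndiffM => //; first exact: ndiff_cst.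
by apply: ndiffV => // p /Wab [_ kv]; rewrite gt_eqF // (lt_trans k0).
Qed.

Lemma jet2_near_gt0 (f : R -> R) b c : jet2 f b c -> 0 < f 0 ->
  \forall s \near (0 : R), 0 < f s.
Proof.
move=> /jet2_continuous cf f0; apply: (cf [set x | 0 < x]).
by apply: open_nbhs_nbhs; split=> //; exact: open_gt.
Qed.

(** The hypotheses on the jets of [a] and [b] describe a geodesic of the sphere
    with squared speed [w], whose acceleration in the ambient space is [- w]
    times the position.  The two formulas are the Hessians
    [Hess v = - v g + v dphi^2] and [v Hess phi = - 2 dv dphi] of the
    cylindrical coordinates. *)
Lemma jet2_polar (a b : R -> R) (a1 b1 w : R)
    (v := polar_radius (a 0) (b 0)) (al := (a 0 * a1 + b 0 * b1) / v)
    (be := (a1 * b 0 - a 0 * b1) / v ^+ 2) :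
  b 0 < v -> jet2 a a1 (- w * a 0) -> jet2 b b1 (- w * b 0) ->
  jet2 (fun s => polar_radius (a s) (b s)) al (v * (be ^+ 2 - w)) /\
  jet2 (fun s => polar_angle (a s) (b s)) be (- 2 * al * be / v).
Proof.
move=> bv ja jb; have y0 : 0 < a 0 ^+ 2 + b 0 ^+ 2 := polar_radius_gt0 bv.
have v0 : 0 < v by rewrite sqrtr_gt0.
have v2 : v ^+ 2 = a 0 ^+ 2 + b 0 ^+ 2 by rewrite sqr_sqrtr // ltW.
have y0' : 0 < a 0 * a 0 + b 0 * b 0 by rewrite -!expr2.
have jy := jet2D (jet2M ja ja) (jet2M jb jb).
have jv : jet2 (fun s => polar_radius (a s) (b s)) al (v * (be ^+ 2 - w)).
  rewrite (_ : (fun s => _) = (fun s => Num.sqrt (a s * a s + b s * b s))); last first.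
    by apply/funext => s; rewrite /polar_radius !expr2.
  apply: (jet2_eq (jet2_sqrt y0' jy)); rewrite -!expr2 -/v; rewrite -/(polar_radius _ _) -/v.
    by rewrite /al; field; rewrite gt_eqF.
  rewrite /be; have a02 : a 0 ^+ 2 = v ^+ 2 - b 0 ^+ 2 by rewrite v2 addrK.
  clearbody v; move: (a 0) (b 0) a02 => x y x2.
  by field: x2; rewrite gt_eqF.
split=> //.
have nv := jet2_near_gt0 (jet2D jv (jet2M (jet2_affine (-1) 0) jb)).
have db := jet2_derive jb; have da := jet2_derive ja.
have dy := is_derive1D (is_derive1M da da) (is_derive1M db db).
move: ja jb => [a' [Da Ea Da']] [b' [Db Eb Db']].
exists (fun s => (a' s * b s - a s * b' s) / (a s * a s + b s * b s)); split.
- have : \forall s \near 0, 0 < polar_radius (a s) (b s) + (-1 + s * 0) * b s.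
    by apply: nv; rewrite mul0r addr0 mulN1r subr_gt0.
  apply: filterS3 Da Db => s; rewrite mulr0 addr0 mulN1r subr_gt0 => Da Db bs.
  by rewrite -!expr2; exact: is_derive_polar_angle.
- by rewrite Ea Eb -!expr2 -v2.
- have y1 : a 0 * a 0 + b 0 * b 0 != 0 by rewrite gt_eqF.
  have dn := is_derive1B (is_derive1M Da' db) (is_derive1M da Db').
  apply: (is_derive_eq (is_derive1_div (g := fun s => a s * a s + b s * b s) y1 dn dy)).
  rewrite Ea Eb -!expr2 -v2 /al /be.
  by field; rewrite gt_eqF.
Qed.

(** If [cos A = k / v], then [k / s] is the cotangent of [A], so that
    [A' = cot A * (v' / v)]. *)
Lemma jet2_acos_div (f : R -> R) b c k (s := Num.sqrt (f 0 ^+ 2 - k ^+ 2)) :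
  0 < k -> k < f 0 -> jet2 f b c ->
  jet2 (fun x => acos (k / f x)) (k / s * (b / f 0))
    (k / s * (c / f 0 - (2 + (k / s) ^+ 2) * (b / f 0) ^+ 2)).
Proof.
move=> k0 kf jf; have f0 : 0 < f 0 by exact: lt_trans kf.
have d0 : 0 < f 0 ^+ 2 - k ^+ 2 by nra.
have s0 : 0 < s by rewrite sqrtr_gt0.
have s2 : s ^+ 2 = f 0 ^+ 2 - k ^+ 2 by rewrite sqr_sqrtr // ltW.
have f2 : f 0 ^+ 2 = s ^+ 2 + k ^+ 2 by rewrite s2 subrK.
apply: (jet2_eq (jet2_comp jf (h := fun x => acos (k / x))
  (h' := fun x => k / (x * Num.sqrt (x * x - k ^+ 2)))
  (d2 := - k * (s ^+ 2 + f 0 ^+ 2) / (f 0 ^+ 2 * s ^+ 3)) _ _)).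
- have : nbhs (f 0) [set x | k < x] by apply: open_nbhs_nbhs; split=> //; exact: open_gt.
  apply: filterS => x /= kx; have x0 : 0 < x by exact: lt_trans kx.
  have kx1 : -1 < k / x < 1.
    by rewrite (@lt_trans _ _ 0) ?divr_gt0 //= ltr_pdivrMr // mul1r.
  have dk : is_derive x 1 (fun y => k / y) ((0 * x - k * 1) / x ^+ 2) :=
    is_derive1_div (g := id) (lt0r_neq0 x0) (is_derive_cst k x 1) (is_derive_id x 1).
  apply: (is_derive_eq (is_derive1_comp (g := fun y => k / y) (is_derive1_acos kx1) dk)).
  rewrite /cst /= (_ : Num.sqrt (1 - _) = Num.sqrt (x * x - k ^+ 2) / x); last first.
    rewrite (_ : 1 - _ = (x * x - k ^+ 2) * x^-1 ^+ 2); last by field; rewrite gt_eqF.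
    by rewrite sqrtrM ?sqrtr_sqr ?ger0_norm ?invr_ge0 ?ltW //; nra.
  have q0 : Num.sqrt (x * x - k ^+ 2) != 0 by rewrite gt_eqF // sqrtr_gt0; nra.
  by field; rewrite q0 gt_eqF.
- have d0' : 0 < f 0 * f 0 - k ^+ 2 by rewrite -expr2.
  have i := is_derive_id (f 0) 1.
  have dq := is_derive1_comp (g := fun x => x * x - k ^+ 2) (is_derive1_sqrt d0')
    (is_derive1B (is_derive1M i i) (is_derive_cst (k ^+ 2) (f 0) 1)).
  have dn := is_derive1M i dq.
  have n0 : f 0 * Num.sqrt (f 0 * f 0 - k ^+ 2) != 0.
    by rewrite mulf_neq0 // gt_eqF // -expr2.
  have := is_derive1_div (g := fun x => x * Num.sqrt (x * x - k ^+ 2)) n0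
    (is_derive_cst k (f 0) 1) dn.
  move=> h; apply: (is_derive_eq h); rewrite /cst /= -!expr2 -/s.
  by field; rewrite !gt_eqF.
- by rewrite -expr2 -/s; field; rewrite !gt_eqF.
- rewrite -expr2 -/s; clearbody s; move: (f 0) f0 f2 => x x0 x2.
  have k2 : k ^+ 2 = x ^+ 2 - s ^+ 2 by rewrite x2 addrC addKr.
  by field: k2; rewrite !gt_eqF.
Qed.

(** Here [x = v' / v], [be = phi'], [ka = cot A] for [A = acos (k / v)], and
    [th], [T] are the hyperbolic tangents of [l (phi - t)] and [l A]. *)
Lemma jet2_wave (a b : R -> R) (a1 b1 w : R) l k t
    (v := polar_radius (a 0) (b 0)) (x := (a 0 * a1 + b 0 * b1) / v ^+ 2)
    (be := (a1 * b 0 - a 0 * b1) / v ^+ 2) (ka := k / Num.sqrt (v ^+ 2 - k ^+ 2))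
    (th := sinh (l * (polar_angle (a 0) (b 0) - t)) / cosh (l * (polar_angle (a 0) (b 0) - t)))
    (T := sinh (l * acos (k / v)) / cosh (l * acos (k / v))) :
  0 < k -> k < v ->
  b 0 < v -> jet2 a a1 (- w * a 0) -> jet2 b b1 (- w * b 0) ->
  exists d, jet2 (fun s => wave l k (a s) (b s) t) d
    (wave l k (a 0) (b 0) t *
     (l ^+ 2 * be ^+ 2 - 2 * l * th * x * be - 2 * l ^+ 2 * th * T * be * ka * x
      + l ^+ 2 * (2 * T ^+ 2 - 1) * ka ^+ 2 * x ^+ 2
      - l * T * ka * (be ^+ 2 - w - (2 + ka ^+ 2) * x ^+ 2))).
Proof.
move=> k0 kv bv ja jb; have [jv jp] := jet2_polar bv ja jb.
have v0 : 0 < v by exact: lt_trans kv.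
have jps := jet2D jp (jet2_affine (- t) 0).
have jA := jet2_acos_div k0 kv jv.
have jc := jet2_cosh l jps; have jC := jet2_cosh l jA.
have C0 : cosh (l * acos (k / polar_radius (a 0) (b 0))) != 0 by rewrite gt_eqF ?cosh_gt0.
have jz := jet2M jc (jet2V (f := fun s => cosh (l * acos (k / polar_radius (a s) (b s)))) C0 jC).
eexists; rewrite (_ : (fun s => wave l k (a s) (b s) t) =
  (fun s => cosh (l * (polar_angle (a s) (b s) + (- t + s * 0))) /
            cosh (l * acos (k / polar_radius (a s) (b s))))); last first.
  by apply/funext => s; rewrite /wave mulr0 addr0.
apply: (jet2_eq jz) => //.
rewrite mulr0 addr0 -/v -/be -/ka /wave -/v.
set al := (a 0 * a1 + b 0 * b1) / v.
have xE : al / v = x by rewrite /al /x expr2 invfM mulrA.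
have alE : al = x * v by rewrite -xE divfK // gt_eqF.
rewrite alE /th /T -/v.
set c := cosh _; set C := cosh _; set S := sinh _; set s := sinh _.
have c0 : c != 0 by rewrite gt_eqF ?cosh_gt0.
have C0' : C != 0 by rewrite gt_eqF ?cosh_gt0.
clearbody v ka x be c C S s.
by field; rewrite C0' c0 gt_eqF.
Qed.

End Wave.

(** * The estimate behind convexity *)

Section Positivity.
Variable R : realType.

(** The form is [Y be^2 - 2 X be x + P x^2 + l T ka N] with the coefficients
    [X], [Y], [P] named in the proof.  In [P Y - X^2] the terms of order [l^4]
    cancel up to the factor [1 - T^2], which is exponentially small, and those
    of order [l^3] add up to something nonnegative: this is the convexity of
    the small sphere [cos phi = k / v].  What remains is at least [- 8 l^2],
    and [Y (l T ka N)], of order [l^3 N], compensates it because [x^2] is at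
    most a multiple of [N]. *)
Lemma wave_form_gt0 (l th T ka v x be N : R) :
  1 <= l -> th ^+ 2 <= 1 -> 0 < T -> T ^+ 2 <= 1 -> l ^+ 2 * (1 - T ^+ 2) <= 16 ->
  0 < ka -> ka ^+ 2 <= 3^-1 -> 0 < v -> v ^+ 2 <= 1 ->
  v ^+ 2 * x ^+ 2 <= (1 - v ^+ 2) * N -> 8 <= T * ka * (l - 1) * v ^+ 2 ->
  0 <= N -> (N = 0 -> be != 0) ->
  0 < l ^+ 2 * be ^+ 2 - 2 * l * th * x * be - 2 * l ^+ 2 * th * T * be * ka * x
      + l ^+ 2 * (2 * T ^+ 2 - 1) * ka ^+ 2 * x ^+ 2
      - l * T * ka * (be ^+ 2 - (N + v ^+ 2 * be ^+ 2) - (2 + ka ^+ 2) * x ^+ 2).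
Proof.
move=> l1 th1 T0 T1 lT ka0 ka1 v0 v1 xN lc N0 Nbe.
have l0 : 0 < l by lra.
have Tle1 : T <= 1 by nra.
have kale1 : ka <= 1 by nra.
have Tka0 : 0 < T * ka by rewrite mulr_gt0.
have Tka1 : T * ka <= 1 by nra.
pose u := 1 - v ^+ 2.
have u0 : 0 <= u by rewrite subr_ge0.
have u1 : u <= 1 by rewrite /u gerBl sqr_ge0.
pose Y := l * (l - T * ka * u).
pose X := l * th * (l * T * ka + 1).
pose P := l ^+ 2 * ka ^+ 2 * (2 * T ^+ 2 - 1) + l * T * ka * (2 + ka ^+ 2).
have Tku : T * ka * u <= 1 by nra.
have Y0 : l * (l - 1) <= Y by rewrite ler_pM2l //; lra.
have ll : 0 < l - 1.
  rewrite lt0r subr_ge0 l1 andbT; apply: contraTneq lc => ->.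
  by rewrite mulr0 mul0r -ltNge; lra.
have Yp : 0 < Y by apply: lt_le_trans Y0; rewrite mulr_gt0.
have D : - (8 * l ^+ 2) <= P * Y - X ^+ 2.
  have X2 : X ^+ 2 <= l ^+ 2 * (l * T * ka + 1) ^+ 2.
    rewrite /X !exprMn -mulrA ler_wpM2l ?sqr_ge0 // ler_piMl ?sqr_ge0 //.
  have E : P * Y - l ^+ 2 * (l * T * ka + 1) ^+ 2 = l ^+ 2 *
     (- (ka ^+ 2 * (l ^+ 2 * (1 - T ^+ 2))) + l * T * ka * ka ^+ 2 * (1 - u * (2 * T ^+ 2 - 1))
      - (T ^+ 2 * u) * (ka ^+ 2 * (2 + ka ^+ 2)) - 1) by rewrite /P /Y; ring.
  have e1 : ka ^+ 2 * (l ^+ 2 * (1 - T ^+ 2)) <= 3^-1 * 16.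
    by rewrite ler_pM ?sqr_ge0 // mulr_ge0 ?sqr_ge0 // subr_ge0.
  have e2 : 0 <= l * T * ka * ka ^+ 2 * (1 - u * (2 * T ^+ 2 - 1)).
    rewrite mulr_ge0 ?sqr_ge0 //; first by rewrite -(mulrA l) mulr_ge0 ?sqr_ge0 // mulr_ge0 // ltW.
    have : u * (2 * T ^+ 2 - 1) <= 1 * 1; last by lra.
    by have := sqr_ge0 T; nra.
  have e3 : (T ^+ 2 * u) * (ka ^+ 2 * (2 + ka ^+ 2)) <= 1 * (3^-1 * (2 + 3^-1)).
    have k2 := sqr_ge0 ka; have T2 := sqr_ge0 T.
    have a1 : T ^+ 2 * u <= 1 by rewrite mulr_ile1.
    have a2 : ka ^+ 2 * (2 + ka ^+ 2) <= 3^-1 * (2 + 3^-1).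
      by rewrite ler_pM ?addr_ge0 // lerD2l.
    have b1 : 0 <= T ^+ 2 * u by rewrite mulr_ge0.
    have b2 : 0 <= ka ^+ 2 * (2 + ka ^+ 2) by rewrite mulr_ge0 // addr_ge0.
    exact: ler_pM.
  have : l ^+ 2 * (- 8) <= P * Y - l ^+ 2 * (l * T * ka + 1) ^+ 2.
    by rewrite E ler_wpM2l ?sqr_ge0 //; lra.
  by lra.
set Q := (X in 0 < X).
have YQ : Y * Q = (Y * be - X * x) ^+ 2 + (P * Y - X ^+ 2) * x ^+ 2 + Y * (l * T * ka * N).
  by rewrite /Q /Y /X /P /u; ring.
rewrite -(pmulr_rgt0 _ Yp) YQ.
have F : l ^+ 2 * (8 * v ^+ 2 * N) <=
    v ^+ 2 * ((P * Y - X ^+ 2) * x ^+ 2 + Y * (l * T * ka * N)).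
  have f1 : - (8 * l ^+ 2) * (u * N) <= (P * Y - X ^+ 2) * (v ^+ 2 * x ^+ 2).
    apply: (@le_trans _ _ (- (8 * l ^+ 2) * (v ^+ 2 * x ^+ 2))).
      by rewrite !mulNr lerN2 ler_wpM2l // mulr_ge0 ?sqr_ge0.
    by rewrite ler_wpM2r // mulr_ge0 ?sqr_ge0.
  have f2 : l ^+ 2 * 8 * N <= Y * (l * T * ka * N) * v ^+ 2.
    apply: (@le_trans _ _ (l * (l - 1) * (l * T * ka * N) * v ^+ 2)).
      rewrite (_ : _ * _ * v ^+ 2 = l ^+ 2 * (T * ka * (l - 1) * v ^+ 2) * N); last by ring.
      by rewrite ler_wpM2r // ler_wpM2l // sqr_ge0.
    rewrite ler_wpM2r ?sqr_ge0 // ler_wpM2r // -(mulrA l T) mulr_ge0 // mulr_ge0 // ltW //.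
  by move: f1 f2; rewrite /u; nra.
have v20 : 0 < v ^+ 2 by rewrite exprn_gt0.
have [N_eq0|Nn0] := eqVneq N 0.
  have x0 : x = 0.
    apply/eqP; rewrite -sqrf_eq0 eq_le sqr_ge0 andbT -(pmulr_rle0 _ v20).
    by rewrite (le_trans xN) // N_eq0 mulr0.
  rewrite N_eq0 x0 expr0n /= !mulr0 !addr0 subr0 exprn_even_gt0 //=.
  by rewrite mulf_neq0 ?(gt_eqF Yp) ?Nbe.
have Np : 0 < N by rewrite lt0r Nn0.
rewrite -addrA ltr_wpDl ?sqr_ge0 // -(pmulr_rgt0 _ v20).
by apply: lt_le_trans F; rewrite !mulr_gt0 ?exprn_gt0.
Qed.

Lemma tanh_sqr (x : R) : 1 - (sinh x / cosh x) ^+ 2 = (cosh x ^+ 2)^-1.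
Proof.
have c0 : cosh x != 0 by rewrite gt_eqF ?cosh_gt0.
have := cosh2Bsinh2 x => h.
apply: (mulIf (expf_neq0 2 c0)); rewrite mulVf ?expf_neq0 // -[RHS]h.
by field.
Qed.

Lemma tanh_sqr_le1 (x : R) : (sinh x / cosh x) ^+ 2 <= 1.
Proof. by rewrite -subr_ge0 tanh_sqr invr_ge0 sqr_ge0. Qed.

(** By the mean value theorem [1 - cos A <= A]. *)
Lemma acos_ge_half (y : R) : 0 < y <= 2^-1 -> 2^-1 <= acos y.
Proof.
move=> /andP[y0 y1]; have yI : -1 <= y <= 1 by apply/andP; split; lra.
have A0 := acos_ge0 yI.
have cc : {within `[0, acos y], continuous cos}.
  by apply: continuous_subspaceT; exact: continuous_cos.
have [x _ ] := MVT_segment A0 (fun x _ => is_derive_cos x) cc.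
rewrite acosK // cos0 subr0 => h.
have := sin_max x; rewrite ler_norml => /andP[s1 s2].
suff : 1 - y <= acos y by lra.
by nra.
Qed.

End Positivity.

(** * The Hessian of the sphere as a second derivative *)

Section Hessian.
Variables (R : realType) (n : nat).
Local Notation E := 'rV[R]_n.+1.
Implicit Types (x y p q u w : E).

(** Both sides are limits of the same difference quotient. *)
Lemma is_derive_line (V : normedModType R) (g : V -> R) (p w : V) (s d : R) :
  is_derive s 1 (fun r : R => g (p + r *: w)) d <-> is_derive (p + s *: w) w g d.
Proof.
have E : (fun h : R => h^-1 *: (((fun r : R => g (p + r *: w)) \o shift s) (h *: (1 : R)) -
    g (p + s *: w))) = (fun h : R => h^-1 *: ((g \o shift (p + s *: w)) (h *: w) - g (p + s *: w))).
  apply/funext => h /=; congr (_ *: (g _ - _)).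
  by rewrite [h *: 1]mulr1 scalerDl addrCA.
split=> -[dg gd]; split.
- by rewrite /derivable -E.
- by rewrite /derive -E.
- by rewrite /derivable E.
- by rewrite /derive E.
Qed.

Lemma dotpC x y : dotp x y = dotp y x.
Proof. by apply: eq_bigr => i _; rewrite mulrC. Qed.

Lemma dotpDl x y u : dotp (x + y) u = dotp x u + dotp y u.
Proof. by rewrite -big_split; apply: eq_bigr => i _; rewrite mxE mulrDl. Qed.

Lemma dotpZl (a : R) x u : dotp (a *: x) u = a * dotp x u.
Proof. by rewrite /dotp mulr_sumr; apply: eq_bigr => i _; rewrite mxE mulrA. Qed.

Lemma dotpDr x y u : dotp u (x + y) = dotp u x + dotp u y.
Proof. by rewrite dotpC dotpDl !(dotpC u). Qed.

Lemma dotpZr (a : R) x u : dotp u (a *: x) = a * dotp u x.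
Proof. by rewrite dotpC dotpZl dotpC. Qed.

Lemma dotp_ge0 x : 0 <= dotp x x.
Proof. by apply: sumr_ge0 => i _; rewrite -expr2 sqr_ge0. Qed.

Lemma enormZ (a : R) x : enorm (a *: x) = `|a| * enorm x.
Proof.
by rewrite /enorm dotpZl dotpZr mulrA -expr2 sqrtrM ?sqr_ge0 // sqrtr_sqr.
Qed.

Lemma sphere_dotp x : sphere x -> dotp x x = 1.
Proof. by move=> h; rewrite -[LHS]sqr_sqrtr ?dotp_ge0 // -/(enorm x) h expr1n. Qed.

Lemma dotp_tangent_line p w s : sphere p -> tangent p w ->
  dotp (p + s *: w) (p + s *: w) = 1 + s ^+ 2 * dotp w w.
Proof.
move=> /sphere_dotp p1 pw.
rewrite dotpDl !dotpDr !dotpZl !dotpZr p1 (dotpC p w) pw; ring.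
Qed.

Lemma ndiff_coord (W : set E) (openW : open W) k i : ndiff W k (fun y : E => y 0 i).
Proof.
apply: ndiff_linear => //; first by move=> a x y; rewrite !mxE.
exact: coord_continuous.
Qed.

Lemma ndiff_sum (V : normedModType R) (W : set V) (openW : open W) k
    (I : Type) (r : seq I) (f : I -> V -> R) :
  (forall i, ndiff W k (f i)) -> ndiff W k (fun z => \sum_(i <- r) f i z).
Proof.
move=> hf; elim: r => [|i r IH].
  by apply: ndiff_eq (ndiff_cst _ k 0) => // z _; rewrite big_nil.
by apply: ndiff_eq (ndiffD _ (hf i) IH) => // z _; rewrite big_cons.
Qed.

Lemma ndiff_dotp (W : set E) (openW : open W) k : ndiff W k (fun y : E => dotp y y).
Proof.
by apply: ndiff_sum => // i; apply: ndiffM => //; exact: ndiff_coord.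
Qed.

Lemma continuous_dotp : continuous (fun y : E => dotp y y).
Proof.
move=> y; apply: differentiable_continuous.
exact: (ndiff_differentiable (ndiff_dotp (@openT E) 0)).
Qed.

Lemma continuous_enorm : continuous (@enorm R n).
Proof.
move=> y; apply: (@continuous_comp _ _ _ (fun y : E => dotp y y) Num.sqrt).
  exact: continuous_dotp.
exact: sqrt_continuous.
Qed.

Lemma near_sphere_neq0 p : sphere p -> \forall y \near p, 0 < enorm y.
Proof.
move=> Sp; have := @cvgr_gt _ _ _ _ _ _ (@continuous_enorm p) 0.
by rewrite Sp; apply.
Qed.

Lemma near_radial_retraction (W : set E) p : open W -> W p -> sphere p ->
  \forall y \near p, W ((enorm y)^-1 *: y).
Proof.
move=> openW Wp Sp.
have cr : {for p, continuous (fun y : E => (enorm y)^-1 *: y)}.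
  apply: continuousZ; last exact: cvg_id.
  by apply: continuousV; [rewrite Sp oner_neq0|exact: continuous_enorm].
apply: (cr W); apply: open_nbhs_nbhs; split=> //.
by rewrite Sp invr1 scale1r.
Qed.

Lemma is_derive_enorm p w : sphere p -> tangent p w -> is_derive p w (@enorm R n) 0.
Proof.
move=> Sp pw; rewrite -[X in is_derive X](addr0 p) -(scale0r w).
apply/is_derive_line.
rewrite (_ : (fun r => _) = (fun r : R => Num.sqrt (1 + r * r * dotp w w))); last first.
  by apply/funext => r; rewrite /enorm dotp_tangent_line.
have i := is_derive_id (0 : R) 1.
have d := is_derive1D (is_derive_cst (1 : R) (0 : R) 1) (is_derive1M (is_derive1M i i)
  (is_derive_cst (dotp w w : R) (0 : R) 1)).
have p0 : 0 < 1 + (0 : R) * 0 * dotp w w by rewrite !mul0r addr0.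
apply: (is_derive_eq (is_derive1_comp (g := fun r => 1 + r * r * dotp w w)
  (is_derive1_sqrt p0) d)).
by rewrite /cst /=; ring.
Qed.

Section RadialExtension.
Variables (f : E -> R) (W : set E).
Hypothesis openW : open W.
Let g y := f ((enorm y)^-1 *: y).
Hypothesis dg : ndiff W 1 g.

Lemma radial_homogeneous (a : R) y : 0 < a -> g (a *: y) = g y.
Proof.
move=> a0; rewrite /g enormZ gtr0_norm // scalerA invfM mulrAC.
by rewrite mulVf ?mul1r // gt_eqF.
Qed.

(** Euler's identity in degree 0. *)
Lemma derive_radial q : W q -> 'D_q g q = 0.
Proof.
move=> Wq; have d := derivableP (diff_derivable (v := q) (ndiff_differentiable dg Wq)).
have : is_derive (q + (0 : R) *: q) q g ('D_q g q) by rewrite scale0r addr0.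
move=> /is_derive_line [_ <-]; rewrite -[RHS](derive_cst (g q) (0 : R) (1 : R)).
apply: near_eq_derive; near=> s.
rewrite -[X in X + _]scale1r -scalerDl radial_homogeneous //.
have : - 1 < s by near: s; apply: open_nbhs_nbhs; split; [exact: open_gt|rewrite /=; lra].
by lra.
Unshelve. all: end_near. Qed.

(** The derivatives of a function that is homogeneous of degree 0 are
    homogeneous of degree -1. *)
Lemma derive_homogeneous (a : R) y u : 0 < a -> W y ->
  is_derive (a *: y) u g (a^-1 * 'D_u g y).
Proof.
move=> a0 Wy.
have d := derivableP (diff_derivable (v := u) (ndiff_differentiable dg Wy)).
rewrite -[a *: y]addr0 -(scale0r u); apply/is_derive_line.
rewrite (_ : (fun r => _) = (fun r : R => g (y + (a^-1 * r) *: u))); last first.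
  apply/funext => r; rewrite -[RHS](radial_homogeneous _ a0) scalerDr scalerA.
  by rewrite mulVKf // gt_eqF.
have d0 : is_derive (y + (a^-1 * 0) *: u) u g ('D_u g y) by rewrite mulr0 scale0r addr0.
have := proj2 (is_derive_line _ _ _ _ _) d0 => d1.
have dm : is_derive (0 : R) 1 (fun r : R => a^-1 * r) (0 * 0 + a^-1 * 1) :=
  is_derive1M (is_derive_cst (a^-1 : R) (0 : R) 1) (is_derive_id (0 : R) 1).
apply: (is_derive_eq (is_derive1_comp (f := fun r => g (y + r *: u)) d1 dm)).
by ring.
Qed.

(** The spherical gradient is the Euclidean gradient of the radial extension,
    since the latter has no radial component. *)
Lemma sgrad_radial q i : W q -> sphere q -> sgrad f q 0 i = 'D_(delta_mx 0 i) g q.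
Proof.
move=> Wq Sq; rewrite mxE /sderive -/g /tproj.
have dq := ndiff_differentiable dg Wq.
rewrite !deriveE // linearB linearZ /= -[X in _ - _ * X]deriveE // derive_radial //.
by rewrite mulr0 subr0.
Qed.

(** By homogeneity, the gradient at [y / |y|] is [|y|] times the Euclidean
    gradient at [y], and the factor [|y|] is stationary at [p] in the tangent
    direction [w]; so the covariant derivative of the gradient is, up to a
    normal vector, the Euclidean one. *)
Lemma Hess_second_derive p w : W p -> sphere p -> tangent p w ->
  Hess f p w w = 'D_w ('D_w g) p.
Proof.
move=> Wp Sp pw; rewrite /Hess /nabla /tproj.
have pw' : dotp p w = 0 by rewrite dotpC.
set X := sderive _ _ _.
rewrite dotpDl -scaleNr dotpZl pw' mulr0 addr0 /X /sderive.
have Eg : \forall y \near p, sgrad f ((enorm y)^-1 *: y) =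
    \row_i (enorm y * 'D_(delta_mx 0 i) g y).
  near=> y; have y0 : 0 < enorm y by near: y; exact: near_sphere_neq0.
  have Wy : W y by near: y; exact: open_nbhs_nbhs.
  apply/rowP => i; rewrite [RHS]mxE sgrad_radial.
  - have iy : 0 < (enorm y)^-1 by rewrite invr_gt0.
    by have [_ ->] := derive_homogeneous (delta_mx 0 i) iy Wy; rewrite invrK.
  - by near: y; exact: near_radial_retraction.
  - by rewrite /sphere /= enormZ gtr0_norm ?invr_gt0 // mulVf // gt_eqF.
rewrite (near_eq_derive _ Eg).
have dgu u : is_derive p w (fun y => enorm y * 'D_u g y) ('D_w ('D_u g) p).
  have Dg := ndiff_derive _ dg.
  have d := derivableP (diff_derivable (v := w) (ndiff_differentiable (Dg u) Wp)).
  apply: (is_derive_eq (is_deriveM (is_derive_enorm Sp pw) d)).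
  by rewrite Sp scale1r scaler0 addr0.
rewrite derive_mx; last first.
  apply/derivable_mxP => i j.
  rewrite (_ : (fun y => _) = (fun y => enorm y * 'D_(delta_mx 0 j) g y)).
    by have [] := dgu (delta_mx 0 j).
  by apply/funext => y; rewrite mxE.
have Dg := ndiff_derive _ dg.
have Dge j := diff_derivable (v := w) (ndiff_differentiable (Dg (delta_mx 0 j)) Wp).
have Ew : \forall y \near p, 'D_w g y = (\sum_j w 0 j *: 'D_(delta_mx 0 j) g) y.
  apply: filterS (open_nbhs_nbhs (conj openW Wp)) => y Wy.
  have dy := ndiff_differentiable dg Wy.
  rewrite fct_sumE deriveE // [X in 'd _ _ X]row_sum_delta linear_sum /=.
  by apply: eq_bigr => j _; rewrite linearZ -deriveE.
rewrite [RHS](near_eq_derive _ Ew) derive_sum; last by move=> j; exact: derivableZ.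
apply: eq_bigr => j _; rewrite mxE deriveZ // mulrC; congr (_ * _).
have [_ <-] := dgu (delta_mx 0 j); congr derive.
by apply/funext => y; rewrite mxE.
Unshelve. all: end_near. Qed.

Lemma Hess_jet2 p w b c : W p -> sphere p -> tangent p w ->
  jet2 (fun r => g (p + r *: w)) b c -> Hess f p w w = c.
Proof.
move=> Wp Sp pw jc; rewrite Hess_second_derive //.
have line_derive h r : ndiff W 0 h -> W (p + r *: w) ->
    is_derive r 1 (fun r => h (p + r *: w)) ('D_w h (p + r *: w)).
  move=> hh Wr; apply: (proj2 (is_derive_line _ _ _ _ _)).
  by apply: derivableP; exact: diff_derivable (ndiff_differentiable hh Wr).
have p0 : p + (0 : R) *: w = p by rewrite scale0r addr0.
suff : jet2 (fun r => g (p + r *: w)) ('D_w g (p + (0 : R) *: w)) ('D_w ('D_w g) p).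
  by move=> h; exact: jet2_unique h jc.
exists (fun r => 'D_w g (p + r *: w)); split; last 1 first.
- rewrite -[X in 'D_w _ X]p0; apply: line_derive; first exact: ndiff_derive.
  by rewrite p0.
- have cl : {for 0, continuous (fun r : R => p + r *: w)}.
    apply: continuousD; first exact: cst_continuous.
    by apply: continuousZr_tmp; exact: cvg_id.
  have Wr : \forall r \near 0, W (p + r *: w).
    by apply: (cl W); apply: open_nbhs_nbhs; split=> //; rewrite p0.
  by apply: filterS Wr => r Wr; apply: line_derive => //; apply: ndiffW dg.
- by [].
Qed.

End RadialExtension.
End Hessian.

(** * The sphere in cylindrical coordinates *)

(** The sum of the squares of [B x_i - C y_i] is [B (A B - C^2)], where [A], [B],
    [C] are the sums of the [x_i^2], [y_i^2], [x_i y_i]. *)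
Lemma sum_CauchySchwarz (R : realType) (I : finType) (P : pred I) (x y : I -> R) :
  (\sum_(i | P i) x i * y i) ^+ 2 <=
  (\sum_(i | P i) x i ^+ 2) * (\sum_(i | P i) y i ^+ 2).
Proof.
set C := \sum_(i | P i) _; set A := \sum_(i | P i) _; set B := \sum_(i | P i) _.
have B0 : 0 <= B by apply: sumr_ge0 => i _; exact: sqr_ge0.
have H : 0 <= B * (A * B - C ^+ 2).
  have -> : B * (A * B - C ^+ 2) = \sum_(i | P i) (B * x i - C * y i) ^+ 2.
    transitivity (\sum_(i | P i) (B ^+ 2 * x i ^+ 2 - 2 * B * C * (x i * y i) + C ^+ 2 * y i ^+ 2)).
      by rewrite big_split sumrB -!mulr_sumr -/A -/B -/C /=; ring.
    by apply: eq_bigr => i _; ring.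
  by apply: sumr_ge0 => i _; exact: sqr_ge0.
have [B_eq0|Bn0] := eqVneq B 0; last first.
  have Bp : 0 < B by rewrite lt0r Bn0.
  by move: H; rewrite pmulr_rge0 // subr_ge0.
rewrite B_eq0 mulr0 (_ : C = 0) ?expr0n // /C big1 // => i Pi.
move/eqP: B_eq0; rewrite psumr_eq0 => [/allP/(_ i)|j _]; last exact: sqr_ge0.
by rewrite mem_index_enum Pi sqrf_eq0 => /(_ isT)/eqP ->; rewrite mulr0.
Qed.

Lemma open_lt_continuous (R : realType) (T : topologicalType) (f g : T -> R) :
  continuous f -> continuous g -> open [set z | f z < g z].
Proof.
move=> cf cg; rewrite (_ : mkset _ = (fun z => g z - f z) @^-1` [set r | 0 < r]).
  apply: open_comp; last exact: open_gt.
  by move=> z _; apply: continuousB; [exact: cg|exact: cf].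
by apply/seteqP; split=> z /=; rewrite subr_gt0.
Qed.

Section Coordinates.
Variables (R : realType) (n : nat).
Hypothesis n_gt0 : (0 < n)%N.
Local Notation E := 'rV[R]_n.+1.
Implicit Types (x y p u w : E) (t : R).
Local Notation rest i := ((i != ord0) && (i != inord 1)).

Lemma inord1_neq0 : (inord 1 : 'I_n.+1) != ord0.
Proof. by rewrite -val_eqE /= inordK. Qed.

Lemma dotp_split u w : dotp u w =
  crd1 u * crd1 w + crd2 u * crd2 w + \sum_(i | rest i) u 0 i * w 0 i.
Proof.
by rewrite /dotp (bigD1 ord0) //= (bigD1 (inord 1)) ?inord1_neq0 //= addrA.
Qed.

Lemma dotp_xpt x t : dotp x (xpt n t) = crd1 x * sin t + crd2 x * cos t.
Proof.
rewrite dotp_split /crd1 /crd2 !mxE eqxx (negbTE inord1_neq0) eqxx big1 ?addr0 //.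
by move=> i /andP[i0 i1]; rewrite mxE (negbTE i0) (negbTE i1) mulr0.
Qed.

Lemma vfun_sqr x : vfun x ^+ 2 = crd1 x ^+ 2 + crd2 x ^+ 2.
Proof. by rewrite sqr_sqrtr // addr_ge0 ?sqr_ge0. Qed.

Lemma sphere_rest x : sphere x -> \sum_(i | rest i) x 0 i ^+ 2 = 1 - vfun x ^+ 2.
Proof.
move=> /sphere_dotp; rewrite dotp_split vfun_sqr -!expr2 => <-.
by rewrite addrC addKr; apply: eq_bigr => i _; rewrite expr2.
Qed.

Lemma vfun_le1 x : sphere x -> vfun x <= 1.
Proof.
move=> /sphere_rest Sx; have : 0 <= 1 - vfun x ^+ 2.
  by rewrite -Sx; apply: sumr_ge0 => i _; exact: sqr_ge0.
by rewrite subr_ge0 -[X in _ <= X](expr1n _ 2) ler_pXn2r ?nnegrE ?sqrtr_ge0.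
Qed.

Lemma VV_crd2 x : VV x -> crd2 x < vfun x.
Proof.
move=> [Sx Hx]; rewrite ltNge; apply/negP => vb; apply: Hx.
have b0 : 0 <= crd2 x by apply: le_trans vb; exact: sqrtr_ge0.
split=> //; apply/eqP; rewrite -sqrf_eq0 eq_le sqr_ge0 andbT.
have : vfun x ^+ 2 <= crd2 x ^+ 2 by rewrite ler_pXn2r ?nnegrE ?sqrtr_ge0.
by rewrite vfun_sqr gerDr.
Qed.

Lemma angleE x : VV x -> angle x = polar_angle (crd1 x) (crd2 x).
Proof.
move=> Vx; have [p0 p1 p2 p3] := polar_angleP (VV_crd2 Vx).
by apply: (is_angle_inj Vx (angleP Vx)); split.
Qed.

Lemma dotp_xpt_angle x t : VV x -> dotp x (xpt n t) = vfun x * cos (angle x - t).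
Proof.
move=> Vx; rewrite dotp_xpt cosB; have [_ _ {1}-> {1}->] := angleP Vx.
by ring.
Qed.

Lemma xpt_eq x t : sphere x -> VV x -> 0 < t -> t < 2 * pi ->
  x = xpt n t <-> vfun x = 1 /\ angle x = t.
Proof.
move=> Sx Vx t0 t1; split=> [xE|[v1 xt]].
  have c1 : crd1 x = sin t by rewrite xE /crd1 mxE eqxx.
  have c2 : crd2 x = cos t by rewrite xE /crd2 mxE (negbTE inord1_neq0) eqxx.
  have v1 : vfun x = 1 by rewrite /vfun c1 c2 addrC cos2Dsin2 sqrtr1.
  split=> //; apply: (is_angle_inj Vx (angleP Vx)).
  by split; rewrite ?v1 ?mul1r.
have [_ _ p2 p3] := angleP Vx; rewrite v1 xt !mul1r in p2 p3.
apply/rowP => i; rewrite mxE; case: eqP => [->|/eqP i0] //.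
case: eqP => [->|/eqP i1] //.
have /eqP := sphere_rest Sx; rewrite v1 expr1n subrr psumr_eq0 => [|j _]; last exact: sqr_ge0.
move=> /allP/(_ i); rewrite mem_index_enum i0 i1 sqrf_eq0 => /(_ isT)/eqP; exact.
Qed.

(** Here [x = v' / v] and [be = phi'] along [w], and [N] is the squared length
    of the part of [w] orthogonal to the rotation field.  As [w] is orthogonal
    to [p], the inner product of their remaining coordinates is [- v v']; the bound is
    the Cauchy-Schwarz inequality for these coordinates, whose squared lengths
    are [1 - v^2] for [p] and [N - v'^2] for [w]. *)
Lemma tangent_split p w (v := vfun p)
    (x := (crd1 p * crd1 w + crd2 p * crd2 w) / v ^+ 2)
    (be := (crd1 w * crd2 p - crd1 p * crd2 w) / v ^+ 2)
    (N := dotp w w - v ^+ 2 * be ^+ 2) :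
  sphere p -> 0 < v -> tangent p w ->
  0 <= N /\ v ^+ 2 * x ^+ 2 <= (1 - v ^+ 2) * N.
Proof.
move=> Sp v0 pw; have vn0 : v != 0 by rewrite gt_eqF.
have v2 : v ^+ 2 = crd1 p ^+ 2 + crd2 p ^+ 2 := vfun_sqr p.
have lag : crd1 w * crd1 w + crd2 w * crd2 w = v ^+ 2 * x ^+ 2 + v ^+ 2 * be ^+ 2.
  rewrite /x /be; have p12 : crd1 p ^+ 2 = v ^+ 2 - crd2 p ^+ 2 by rewrite v2 addrK.
  clearbody v; move: (crd1 p) (crd2 p) (crd1 w) (crd2 w) p12 => a b a1 b1 a2.
  by field: a2.
set B := \sum_(i | rest i) w 0 i ^+ 2.
have wE : dotp w w = v ^+ 2 * x ^+ 2 + v ^+ 2 * be ^+ 2 + B.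
  by rewrite dotp_split lag; congr (_ + _); apply: eq_bigr => i _; rewrite expr2.
have B0 : 0 <= B by apply: sumr_ge0 => i _; exact: sqr_ge0.
have NE : N = v ^+ 2 * x ^+ 2 + B by rewrite /N wE; ring.
have CS := sum_CauchySchwarz (fun i => rest i) (fun i => w 0 i) (fun i => p 0 i).
have CE : \sum_(i | rest i) w 0 i * p 0 i = - (v ^+ 2 * x).
  have := pw; rewrite /tangent /= dotp_split => h.
  rewrite /x [v ^+ 2 * _]mulrC divfK ?expf_neq0 //.
  by lra.
move: CS; rewrite CE sqrrN -/B sphere_rest // -/v => CS.
have x2 := sqr_ge0 x; have v20 := sqr_ge0 v.
split; first by rewrite NE addr_ge0 // mulr_ge0.
by rewrite NE; nra.
Qed.

End Coordinates.

(** * The family of convex functions *)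

Lemma wave_gt0 (R : realType) (l k a b t : R) : 0 < wave l k a b t.
Proof. exact: divr_gt0 (cosh_gt0 _) (cosh_gt0 _). Qed.

Section Family.
Variables (R : realType) (n : nat).
Hypothesis n_gt0 : (0 < n)%N.
Variable c : R.
Hypotheses (c_gt0 : 0 < c) (c_le : c <= 3^-1).
Local Notation E := 'rV[R]_n.+1.
Implicit Types (x y p u w : E) (t : R).

(** The height of the caps [(x, x_t) >= 3 c / 2]. *)
Definition cap_height : R := 3 / 2 * c.
(** The estimate [wave_form_gt0] asks for [l - 1 >= 8 / (T ka v^2)], where [T >= 1/2],
    [ka >= 3 c / 2] and [v >= 3 c]. *)
Definition steepness : R := 1 + 2 / c ^+ 3.
Local Notation k := cap_height.
Local Notation l := steepness.
(** The value of [wave] at the centre [x_t] of the cap, where [v = 1]. *)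
Definition wave_min : R := (cosh (l * acos k))^-1.
Definition cap_family x t : R :=
  (wave l k (crd1 x) (crd2 x) t - wave_min) / (1 - wave_min).

Lemma cap_height_bounds : 0 < k <= 2^-1.
Proof. by rewrite /cap_height; apply/andP; split; move: c_gt0 c_le; lra. Qed.

Lemma steepness_ge : 28 <= l.
Proof.
have c3 : c ^+ 3 <= 3^-1 ^+ 3 by rewrite ler_pXn2r ?nnegrE ?invr_ge0 ?(ltW c_gt0).
have c30 : 0 < c ^+ 3 by rewrite exprn_gt0.
have : 27 <= (c ^+ 3)^-1.
  by rewrite -[27]invrK lef_pV2 ?posrE ?invr_gt0 // (le_trans c3) //; lra.
by rewrite /steepness; lra.
Qed.

Lemma steepness_gt0 : 0 < l.
Proof. by have := steepness_ge; lra. Qed.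

Lemma cap_ratio_bounds (v : R) : 2 * k <= v -> 0 < k / v <= 2^-1.
Proof.
have /andP[k0 _] := cap_height_bounds; move=> kv.
have v0 : 0 < v by lra.
by rewrite divr_gt0 //= ler_pdivrMr //; lra.
Qed.

Lemma wave_min_lt1 : wave_min < 1.
Proof.
rewrite invf_lt1 ?cosh_gt0 // -cosh0 ltr_cosh // mulr_gt0 ?steepness_gt0 //.
have := acos_ge_half cap_height_bounds; lra.
Qed.

(** [1 - T^2 = 1 / cosh^2 (l A)], and [cosh (l A) >= l A / 2 >= l / 4] since
    [A >= 1/2]. *)
Lemma tanh_bounds (v : R) (T := sinh (l * acos (k / v)) / cosh (l * acos (k / v))) :
  2 * k <= v -> 2^-1 <= T /\ l ^+ 2 * (1 - T ^+ 2) <= 16.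
Proof.
move=> /cap_ratio_bounds /acos_ge_half A2; have l28 := steepness_ge.
have lA : 0 < l * acos (k / v) by rewrite mulr_gt0 //; lra.
have T0 : 0 < T by rewrite divr_gt0 ?sinh_gt0 ?cosh_gt0.
have C4 : l / 4 <= cosh (l * acos (k / v)).
  apply: le_trans (cosh_ge_half _); rewrite -[4]/((2 * 2)%:R) natrM invfM mulrA.
  by rewrite ler_pM2r ?invr_gt0 // ler_pM2l //; lra.
have lT : l ^+ 2 * (1 - T ^+ 2) <= 16.
  rewrite tanh_sqr ler_pdivrMr ?exprn_gt0 ?cosh_gt0 //.
  have : (l / 4) ^+ 2 <= cosh (l * acos (k / v)) ^+ 2.
    by rewrite ler_pXn2r ?nnegrE ?(ltW (cosh_gt0 _)) // divr_ge0 //; lra.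
  by rewrite expr_div_n; lra.
split=> //; rewrite leNgt; apply/negP => Th.
have T2 : T ^+ 2 <= 2^-1 by move: T T0 Th {lT} => T T0 Th; nra.
have l2 : 28 ^+ 2 <= l ^+ 2 by rewrite ler_pXn2r ?nnegrE //; lra.
move: (l ^+ 2) (T ^+ 2) l2 T2 lT => L S L2 S2 LS; nra.
Qed.

(** The square root is at most [1] because [v <= 1], and at least [sqrt 3 * k]
    because [v >= 2 k]. *)
Lemma cap_slope_bounds (v : R) (ka := k / Num.sqrt (v ^+ 2 - k ^+ 2)) :
  2 * k <= v -> v <= 1 -> k <= ka /\ ka ^+ 2 <= 3^-1.
Proof.
have /andP[k0 k2] := cap_height_bounds; move=> kv v1.
have d0 : 3 * k ^+ 2 <= v ^+ 2 - k ^+ 2 by nra.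
have d1 : v ^+ 2 - k ^+ 2 <= 1 by nra.
have dp : 0 < v ^+ 2 - k ^+ 2 by apply: lt_le_trans d0; rewrite mulr_gt0 ?exprn_gt0.
split.
  have s1 : Num.sqrt (v ^+ 2 - k ^+ 2) <= 1 by rewrite -sqrtr1 ler_wsqrtr.
  by rewrite ler_pdivlMr ?sqrtr_gt0 // ler_piMr // ltW.
by rewrite expr_div_n sqr_sqrtr ?(ltW dp) // ler_pdivrMr //; lra.
Qed.

(** This is a coordinate of the curve [(p + s u) / |p + s u|], for a tangent
    vector [u] at the unit vector [p]: [x] and [y] are the coordinates of [p]
    and [u], and [w] is [|u|^2]. *)
Lemma jet2_radial (x y w : R) :
  jet2 (fun s => (Num.sqrt (1 + s ^+ 2 * w))^-1 * (x + s * y)) y (- w * x).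
Proof.
have q0 : 0 < 1 + 0 ^+ 2 * w by rewrite expr0n /= mul0r addr0.
have j0 : jet2 (fun s => 1 + s ^+ 2 * w) 0 (2 * w).
  rewrite (_ : (fun s => _) = (fun s => (1 + s * 0) + (0 + s * 1) * (0 + s * w))).
    apply: (jet2_eq (jet2D (jet2_affine 1 0) (jet2M (jet2_affine 0 1) (jet2_affine 0 w)))).
    - by ring.
    - by ring.
  by apply/funext => s; ring.
have s1 : Num.sqrt (1 + 0 ^+ 2 * w) = 1 by rewrite expr0n /= mul0r addr0 sqrtr1.
have jv := jet2V (f := fun s => Num.sqrt (1 + s ^+ 2 * w)) _ (jet2_sqrt q0 j0).
rewrite s1 oner_neq0 in jv; apply: (jet2_eq (jet2M (jv isT) (jet2_affine x y))).
- by rewrite s1; field.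
- by rewrite s1; field.
Qed.

Lemma radiusZ (r a b : R) : 0 <= r -> polar_radius (r * a) (r * b) = r * polar_radius a b.
Proof.
move=> r0; rewrite /polar_radius !exprMn -mulrDr sqrtrM ?sqr_ge0 // sqrtr_sqr.
by rewrite ger0_norm.
Qed.

(** The cone over the part of the sphere where the formula for [cap_family] is
    smooth; the factor [enorm y] makes the condition [k < v] homogeneous. *)
Definition cap_family_domain : set E :=
  [set y | crd2 y < vfun y] `&` [set y | k * enorm y < vfun y].

Lemma continuous_crd1 : continuous (@crd1 R n).
Proof. exact: coord_continuous. Qed.

Lemma continuous_crd2 : continuous (@crd2 R n).
Proof. exact: coord_continuous. Qed.

Lemma continuous_vfun : continuous (@vfun R n).
Proof.
move=> y; apply: (@continuous_comp _ _ _ (fun y : E => crd1 y ^+ 2 + crd2 y ^+ 2) Num.sqrt).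
  apply: continuousD; apply: (@continuous_comp _ _ _ _ (fun r : R => r ^+ 2)).
  - exact: continuous_crd1.
  - exact: exprn_continuous.
  - exact: continuous_crd2.
  - exact: exprn_continuous.
exact: sqrt_continuous.
Qed.

Lemma open_cap_family_domain : open cap_family_domain.
Proof.
apply: openI; apply: open_lt_continuous; try exact: continuous_vfun.
  exact: continuous_crd2.
move=> y; apply: (@continuous_comp _ _ _ (@enorm R n) ( *%R k)).
  exact: continuous_enorm.
exact: mulrl_continuous.
Qed.

Lemma ndiff_cap_family (V : normedModType R) (W : set V) (openW : open W) j (a b t : V -> R) :
  (forall z, W z -> b z < polar_radius (a z) (b z) /\ k < polar_radius (a z) (b z)) ->
  ndiff W j a -> ndiff W j b -> ndiff W j t ->
  ndiff W j (fun z => (wave l k (a z) (b z) (t z) - wave_min) / (1 - wave_min)).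
Proof.
move=> Wab ha hb ht; have /andP[k0 _] := cap_height_bounds.
apply: ndiffM => //; last exact: ndiff_cst.
apply: ndiffB => //; last exact: ndiff_cst.
exact: ndiff_wave.
Qed.

Lemma vfun_dotp y : vfun y ^+ 2 <= dotp y y.
Proof.
rewrite dotp_split // vfun_sqr -!expr2 lerDl.
by apply: sumr_ge0 => i _; rewrite -expr2 sqr_ge0.
Qed.

Lemma ndiff_radial_cap_family t : ndiff cap_family_domain 1
  (fun y => cap_family ((enorm y)^-1 *: y) t).
Proof.
have oW := open_cap_family_domain.
have y0 y : cap_family_domain y -> 0 < dotp y y.
  by move=> [/polar_radius_gt0 + _]; rewrite -vfun_sqr => h; apply: lt_le_trans h (vfun_dotp y).
have e0 y : cap_family_domain y -> 0 < (enorm y)^-1.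
  by move=> /y0 h; rewrite invr_gt0 sqrtr_gt0.
have he : ndiff cap_family_domain 1 (fun y => (enorm y)^-1).
  apply: ndiffV => // [y /e0|]; first by rewrite invr_gt0 => h; rewrite gt_eqF.
  by apply: ndiff_sqrt => //; exact: ndiff_dotp.
rewrite /cap_family; apply: ndiff_cap_family => //; last exact: ndiff_cst.
- move=> y Wy; have [bv kv] := Wy; rewrite /crd1 /crd2 !mxE radiusZ ?ltW ?e0 //.
  by rewrite !(ltr_pM2l (e0 _ Wy)) // mulrC ltr_pdivlMr // -invr_gt0 e0.
- rewrite (_ : (fun z => _) = (fun z => (enorm z)^-1 * z 0 ord0)).
    by apply: ndiffM => //; exact: ndiff_coord.
  by apply/funext => y; rewrite /crd1 mxE.
- rewrite (_ : (fun z => _) = (fun z => (enorm z)^-1 * z 0 (inord 1))).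
    by apply: ndiffM => //; exact: ndiff_coord.
  by apply/funext => y; rewrite /crd2 mxE.
Qed.

(** On [v >= 3 c = 2 k] the cotangent [ka] of [A] lies between [k] and
    [1 / sqrt 3], and [l A] is large; these are the inputs of [wave_form_gt0]. *)
Lemma Hess_cap_family_gt0 p w t : VV p -> 3 * c <= vfun p -> tangent p w -> w != 0 ->
  0 < Hess (cap_family ^~ t) p w w.
Proof.
move=> Vp vc pw w0; have [Sp _] := Vp; have /andP[k0 k2] := cap_height_bounds.
have kv : 2 * k <= vfun p by rewrite /cap_height; lra.
have kv' : k < vfun p by lra.
have v0 : 0 < vfun p by lra.
have v1 := vfun_le1 n_gt0 Sp.
have bv := VV_crd2 Vp.
have Wp : cap_family_domain p by split; rewrite //= Sp mulr1.
pose a s := (Num.sqrt (1 + s ^+ 2 * dotp w w))^-1 * (crd1 p + s * crd1 w).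
pose b s := (Num.sqrt (1 + s ^+ 2 * dotp w w))^-1 * (crd2 p + s * crd2 w).
have s1 : (Num.sqrt (1 + 0 ^+ 2 * dotp w w))^-1 = 1.
  by rewrite expr0n /= mul0r addr0 sqrtr1 invr1.
have a0 : a 0 = crd1 p by rewrite /a s1 mul0r addr0 mul1r.
have b0 : b 0 = crd2 p by rewrite /b s1 mul0r addr0 mul1r.
have ja : jet2 a (crd1 w) (- dotp w w * a 0) by rewrite a0; exact: jet2_radial.
have jb : jet2 b (crd2 w) (- dotp w w * b 0) by rewrite b0; exact: jet2_radial.
have := @jet2_wave R a b (crd1 w) (crd2 w) (dotp w w) l k t.
rewrite a0 b0 -[polar_radius _ _]/(vfun p); case=> // [||d jz].
- by move: ja; rewrite a0.
- by move: jb; rewrite b0.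
have m1 : 0 < 1 - wave_min by rewrite subr_gt0 wave_min_lt1.
have jf := jet2M (jet2D jz (jet2_affine (- wave_min) 0)) (jet2_affine (1 - wave_min)^-1 0).
have E : (fun s => cap_family ((enorm (p + s *: w))^-1 *: (p + s *: w)) t) =
  (fun s => (wave l k (a s) (b s) t + (- wave_min + s * 0)) * ((1 - wave_min)^-1 + s * 0)).
  apply/funext => s; rewrite /cap_family /crd1 /crd2 !mxE /a /b /enorm dotp_tangent_line //.
  by rewrite mulr0 !addr0.
rewrite -E in jf.
rewrite (Hess_jet2 open_cap_family_domain (ndiff_radial_cap_family t) Wp Sp pw jf).
rewrite !mulr0 !addr0 mulr_gt0 ?invr_gt0 // mulr_gt0 ?wave_gt0 //.
have [T2 lT] := tanh_bounds kv.
have [ka1 ka2] := cap_slope_bounds kv v1.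
have [N0 xN] := tangent_split n_gt0 Sp v0 pw.
set T := sinh _ / cosh _ in T2 lT *; set ka := k / _ in ka1 ka2 *.
set be := (crd1 w * crd2 p - crd1 p * crd2 w) / _ in N0 xN *.
set x := (crd1 p * crd1 w + crd2 p * crd2 w) / _ in xN *.
set N := dotp w w - _ in N0 xN.
have wE : dotp w w = N + vfun p ^+ 2 * be ^+ 2 by rewrite /N subrK.
rewrite wE.
apply: wave_form_gt0 => //.
- by have := steepness_ge; lra.
- exact: tanh_sqr_le1.
- lra.
- exact: tanh_sqr_le1.
- lra.
- by rewrite expr_le1 // ltW.
- have Tka : 2^-1 * k <= T * ka by rewrite ler_pM // ltW.
  have v2 : 9 * c ^+ 2 <= vfun p ^+ 2.
    rewrite (_ : 9 * c ^+ 2 = (3 * c) ^+ 2); last by ring.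
    by rewrite ler_pXn2r ?nnegrE ?mulr_ge0 ?(ltW c_gt0) ?(ltW v0).
  have -> : l - 1 = 2 / c ^+ 3 by rewrite /steepness addrC addKr.
  have c30 : 0 < 2 / c ^+ 3 by rewrite divr_gt0 // exprn_gt0.
  (* The product of the lower bounds of the four factors is [27 / 2]. *)
  apply: (@le_trans _ _ (2^-1 * k * (2 / c ^+ 3) * (9 * c ^+ 2))).
    rewrite (_ : _ * (9 * _) = 27 / 2); first by lra.
    by rewrite /cap_height; field; rewrite gt_eqF.
  rewrite ler_pM // ?ler_pM2r //; last by rewrite mulr_ge0 // sqr_ge0.
  by rewrite mulr_ge0 ?(ltW c30) // mulr_ge0 // ltW.
- move=> N_eq0; apply: contraNneq w0 => be0.
  move: wE; rewrite N_eq0 be0 expr0n mulr0 addr0 => /eqP.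
  rewrite psumr_eq0 => [/allP ww|i _]; last by rewrite -expr2 sqr_ge0.
  apply/eqP/rowP => i; rewrite mxE; apply/eqP.
  by have := ww i; rewrite mem_index_enum -expr2 sqrf_eq0 => /(_ isT).
Qed.

Section Sublevels.
Variables (x : E) (t : R).
Hypotheses (Vx : VV x) (vx : 2 * c < vfun x).

Let A := acos (k / vfun x).

Lemma ratio_in_itv : 0 < k / vfun x < 1.
Proof.
have /andP[k0 k1] := cap_height_bounds.
have v0 : 0 < vfun x by move: c_gt0 vx; lra.
by rewrite divr_gt0 //= ltr_pdivrMr // mul1r /cap_height; move: c_gt0 vx; lra.
Qed.

Let Apos : 0 <= A <= pi.
Proof.
have /andP[r0 r1] := ratio_in_itv.
by rewrite acos_ge0 ?acos_lepi //; apply/andP; split; lra.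
Qed.

Let cosA : vfun x * cos A = 3 / 2 * c.
Proof.
have /andP[r0 r1] := ratio_in_itv.
rewrite acosK; last by rewrite in_itv /=; apply/andP; split; lra.
by rewrite mulrC divfK // gt_eqF // vfun_gt0.
Qed.

Lemma cap_family_le1 : (cap_family x t <= 1) = (`|angle x - t| <= A).
Proof.
have m1 := wave_min_lt1; have l0 := steepness_gt0.
rewrite /cap_family ler_pdivrMr ?subr_gt0 // mul1r lerD2r /wave ler_pdivrMr ?cosh_gt0 //.
rewrite mul1r ler_cosh_norm !normrM ler_pM2l ?normr_gt0 ?gt_eqF // angleE //.
by rewrite [X in _ <= X]ger0_norm //; case/andP: Apos.
Qed.

Lemma cap_family_lt1 : (cap_family x t < 1) = (`|angle x - t| < A).
Proof.
have m1 := wave_min_lt1; have l0 := steepness_gt0.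
rewrite /cap_family ltr_pdivrMr ?subr_gt0 // mul1r ltrD2r /wave ltr_pdivrMr ?cosh_gt0 //.
rewrite mul1r ltr_cosh_norm !normrM ltr_pM2l ?normr_gt0 ?gt_eqF // angleE //.
by rewrite [X in _ < X]ger0_norm //; case/andP: Apos.
Qed.

Lemma dotp_xptE : dotp x (xpt n t) = vfun x * cos `|angle x - t|.
Proof.
rewrite dotp_xpt_angle //; congr (_ * _).
by case: (leP 0 (angle x - t)) => h; [rewrite ger0_norm|rewrite ltr0_norm // cosN].
Qed.

Lemma cap_family_le1P : cap_family x t <= 1 <->
  3 / 2 * c <= dotp x (xpt n t) /\ `|angle x - t| <= pi.
Proof.
have v0 := vfun_gt0 Vx; have /andP[A0 Api] := Apos.
rewrite cap_family_le1 dotp_xptE -cosA ler_pM2l //.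
have E : `|angle x - t| <= pi -> (cos A <= cos `|angle x - t|) = (`|angle x - t| <= A).
  by move=> h; rewrite !leNgt ltr_cos // in_itv /= ?normr_ge0 ?A0.
split=> [h|[h1 h2]]; last by rewrite -E.
by have h2 := le_trans h Api; rewrite E.
Qed.

Lemma cap_family_lt1P : cap_family x t < 1 <->
  3 / 2 * c < dotp x (xpt n t) /\ `|angle x - t| <= pi.
Proof.
have v0 := vfun_gt0 Vx; have /andP[A0 Api] := Apos.
rewrite cap_family_lt1 dotp_xptE -cosA ltr_pM2l //.
have E : `|angle x - t| <= pi -> (cos A < cos `|angle x - t|) = (`|angle x - t| < A).
  by move=> h; rewrite ltr_cos // in_itv /= ?normr_ge0 ?A0.
split=> [h|[h1 h2]]; last by rewrite -E.
by have h2 := le_trans (ltW h) Api; rewrite E.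
Qed.

Let Amax : A <= acos k.
Proof.
have /andP[r0 r1] := ratio_in_itv; have /andP[k0 k1] := cap_height_bounds.
have kI : -1 <= k <= 1 by apply/andP; split; lra.
have i1 : A \in `[0, pi] by rewrite in_itv.
have i2 : acos k \in `[0, pi] by rewrite in_itv /= acos_ge0 // acos_lepi.
rewrite leNgt -(ltr_cos i2 i1) -leNgt !acosK ?in_itv //=; last by apply/andP; split; lra.
have [Sx _] := Vx; have v1 := vfun_le1 n_gt0 Sx.
by rewrite ler_pdivlMr ?vfun_gt0 // ler_piMr // ltW.
Qed.

Lemma wave_ge : wave_min <= wave l k (crd1 x) (crd2 x) t.
Proof.
have l0 := steepness_gt0; have /andP[A0 _] := Apos.
have cA : cosh (l * A) <= cosh (l * acos k).
  rewrite ler_cosh_norm !normrM ler_pM2l ?normr_gt0 ?gt_eqF //.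
  by rewrite !ger0_norm // (le_trans A0).
have cV : (cosh (l * acos k))^-1 <= (cosh (l * A))^-1.
  by rewrite lef_pV2 ?posrE ?cosh_gt0.
rewrite /wave_min /wave (le_trans cV) //.
by rewrite ler_peMl ?cosh_ge1 // invr_ge0 ltW // cosh_gt0.
Qed.

Lemma cap_family_ge0 : 0 <= cap_family x t.
Proof. by rewrite divr_ge0 // subr_ge0 ?wave_ge // ltW // wave_min_lt1. Qed.

Lemma cap_family_eq0P : cap_family x t = 0 <-> vfun x = 1 /\ angle x = t.
Proof.
have m1 := wave_min_lt1; have l0 := steepness_gt0; have /andP[A0 _] := Apos.
have m0 : 1 - wave_min != 0 by rewrite gt_eqF // subr_gt0.
have E : cap_family x t = 0 <-> wave l k (crd1 x) (crd2 x) t = wave_min.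
  rewrite /cap_family; split=> [/eqP|->]; last by rewrite subrr mul0r.
  by rewrite mulf_eq0 invr_eq0 (negbTE m0) orbF subr_eq0 => /eqP.
rewrite E /wave -angleE // -[polar_radius _ _]/(vfun x) -/A; split; last first.
  by move=> [v1 ->]; rewrite subrr mulr0 cosh0 mul1r /A v1 divr1.
have cA : cosh (l * A) <= cosh (l * acos k).
  rewrite ler_cosh_norm !normrM ler_pM2l ?normr_gt0 ?gt_eqF //.
  by rewrite !ger0_norm // (le_trans A0).
have C0 := cosh_gt0 (l * A); have C1 := cosh_gt0 (l * acos k).
have c1 := cosh_ge1 (l * (angle x - t)).
(* A product of [cosh (l (phi - t)) >= 1] with the maximum of [cosh (l A)]
   equals a value of [cosh (l A)]: both inequalities are equalities. *)
rewrite /wave_min => /(canRL (mulfVK (lt0r_neq0 C0))) cE.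
have cC : cosh (l * (angle x - t)) * cosh (l * acos k) = cosh (l * A).
  by rewrite cE mulrAC mulVf ?mul1r // gt_eqF.
have c_eq1 : cosh (l * (angle x - t)) = 1 by nra.
have AE : A = acos k.
  apply/le_anti; rewrite Amax /= leNgt; apply/negP => A_lt.
  have : cosh (l * A) < cosh (l * acos k) by rewrite ltr_cosh ?ltr_pM2l // mulr_ge0 // ltW.
  by rewrite -cC c_eq1 mul1r ltxx.
have /andP[r0 r1] := ratio_in_itv; have /andP[k0 k1] := cap_height_bounds.
split.
  have := congr1 cos AE; rewrite !acosK ?in_itv /=; [|by apply/andP; split; lra..].
  move=> /(canRL (mulfVK (lt0r_neq0 (vfun_gt0 Vx)))) kE.
  by apply: (mulfI (lt0r_neq0 k0)); rewrite mulr1 -kE.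
have /eqP := cosh_eq1 c_eq1; rewrite mulf_eq0 (gt_eqF l0) /= subr_eq0.
by move/eqP.
Qed.

End Sublevels.

Lemma smooth_on_cap_family (A : set E) (Phi : set R) :
  A `<=` UU c -> smooth_on (A `*` Phi) (fun z : E * R => cap_family z.1 z.2).
Proof.
move=> AU z [/AU [Vz vz] _].
pose W : set (E * R) := [set z | crd2 z.1 < vfun z.1] `&` [set z | k < vfun z.1].
have oW : open W.
  apply: openI; apply: open_lt_continuous => y.
  - by apply: (@continuous_comp _ _ _ (@fst E R)); [exact: cvg_fst|exact: continuous_crd2].
  - by apply: (@continuous_comp _ _ _ (@fst E R)); [exact: cvg_fst|exact: continuous_vfun].
  - exact: cst_continuous.
  - by apply: (@continuous_comp _ _ _ (@fst E R)); [exact: cvg_fst|exact: continuous_vfun].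
exists W, (fun z : E * R => cap_family z.1 z.2); split=> //.
  split=> /=; first exact: VV_crd2.
  by move: c_gt0 vz; rewrite /cap_height; lra.
apply: smooth_open_ndiff => // j; apply: ndiff_cap_family => //.
- apply: ndiff_linear => //; first by move=> a x y; rewrite /crd1 !mxE.
  move=> y; apply: (@continuous_comp _ _ _ (@fst E R)); [exact: cvg_fst|exact: continuous_crd1].
- apply: ndiff_linear => //; first by move=> a x y; rewrite /crd2 !mxE.
  move=> y; apply: (@continuous_comp _ _ _ (@fst E R)); [exact: cvg_fst|exact: continuous_crd2].
- by apply: ndiff_linear => // y; exact: cvg_snd.
Qed.

Lemma smooth_on_cap_family_slice t : smooth_on (@UU R n c) (cap_family ^~ t).
Proof.
move=> x [Vx vx].
pose W : set E := [set y | crd2 y < vfun y] `&` [set y | k < vfun y].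
have oW : open W.
  apply: openI; apply: open_lt_continuous; try exact: continuous_vfun.
    exact: continuous_crd2.
  exact: cst_continuous.
exists W, (cap_family ^~ t); split=> //.
  split=> /=; first exact: VV_crd2.
  by move: c_gt0 vx; rewrite /cap_height; lra.
apply: smooth_open_ndiff => // j; apply: ndiff_cap_family => //.
- exact: ndiff_coord.
- exact: ndiff_coord.
- exact: ndiff_cst.
Qed.

End Family.

Theorem theorem3p1 (R : realType) (n : nat) (n_ge2 : (2 <= n)%N)
    (K : set 'rV[R]_n.+1) (K_compact : compact K) (K_VV : K `<=` @VV R n)
    (c : R) (c_gt0 : 0 < c) (c_le : c <= 3^-1)
    (K_v : forall x, K x -> 3 * c <= vfun x)
    (Phi : set R) (Phi_compact : compact Phi)
    (Phi_sub : Phi `<=` [set t | 0 < t < 2 * pi]) :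
  exists F : 'rV[R]_n.+1 -> R -> R,
    [/\ smooth_on (@UU R n c `*` Phi) (fun z : 'rV[R]_n.+1 * R => F z.1 z.2),
        forall t, Phi t ->
          smooth_on (@UU R n c) (F ^~ t) /\ (forall x, UU c x -> 0 <= F x t),
        forall t, Phi t -> strictly_convex_on K (F ^~ t),
        forall x t, UU c x -> Phi t -> (F x t = 0 <-> x = xpt n t) &
        forall x t, UU c x -> Phi t ->
          (F x t <= 1 <->
             3 / 2 * c <= dotp x (xpt n t) /\ `|angle x - t| <= pi) /\
          (F x t < 1 <->
             3 / 2 * c < dotp x (xpt n t) /\ `|angle x - t| <= pi)].
Proof.
have n0 : (0 < n)%N by exact: leq_trans n_ge2.
exists (cap_family c); split.
- exact: smooth_on_cap_family.
- move=> t _; split=> [|x [Vx vx]]; first exact: smooth_on_cap_family_slice.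
  exact: cap_family_ge0.
- move=> t _ p Kp w pw w0; apply: Hess_cap_family_gt0 => //; first exact: K_VV.
  exact: K_v.
- move=> x t [Vx vx] /Phi_sub /andP[t0 t1]; have [Sx _] := Vx.
  by rewrite cap_family_eq0P // xpt_eq.
- move=> x t [Vx vx] _; split; first exact: cap_family_le1P.
  exact: cap_family_lt1P.
Qed.
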